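(* Let $k$ be a field, $Q$ a finite quiver and $q\in(k^\times)^{Q_0}$. Suppose that $\Lambda^q(Q)$ satisfies the strong free product property, i.e. that $(L_Q,\rho-q,\sigma,kQ_0[t,(t+q)^{-1}])$ satisfies the strong free product property for some choice of section $\sigma$. Then $$H_*(\Lambda^{dg,q}(Q))=H_0(\Lambda^{dg,q}(Q))\cong\Lambda^q(Q),$$ so in particular the dg multiplicative preprojective algebra $\Lambda^{dg,q}(Q)$ is formal.
   Context: Let $\overline{Q}$ be the double of $Q$ (a reverse arrow $a^*$ added for each $a\in Q_1$, $(a^* )^*=a$), $\epsilon(a)=1$ for $a\in Q_1$ and $-1$ for $a\in\overline{Q}_1\setminus Q_1$; $kQ_0=\bigoplus_{i\in Q_0}ke_i$. Put $L_Q=k\overline{Q}[(1+aa^* )^{-1}]_{a\in\overline{Q}_1}$, and, for a fixed total order on $\overline{Q}_1$, $\rho=\prod_{a\in\overline{Q}_1}(1+aa^* )^{\epsilon(a)}$. With $q$ identified with $\sum q_ie_i$, $\Lambda^q(Q)=L_Q/(\rho-q)$. The dg multiplicative preprojective algebra $\Lambda^{dg,q}(Q)$ is the dg-algebra over $kQ_0$ which as a graded algebra is $L_Q*_{kQ_0}kQ_0[s]$ with $|s|=-1$ and $L_Q$ in degree $0$, with differential the $kQ_0$-linear derivation determined by $d(s)=\rho-q$ and $d|_{L_Q}=0$. (Here $kQ_0[s]$ denotes the free graded algebra over $kQ_0$ on $s$, with $s$ commuting with the $e_i$; $s^2\neq 0$.) Strong free product property: let $r=\rho-q$, $B=kQ_0[t,(q+t)^{-1}]$,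 $\overline{B}=tB$, so $B=kQ_0\oplus\overline{B}$, and $\tau:B\to L_Q$ the $kQ_0$-algebra map with $\tau(t)=r$. For a $kQ_0$-bimodule section $\sigma:\Lambda^q(Q)\to L_Q$ of the quotient map with $\sigma(1)=1$, let $\sigma':\Lambda^q(Q)*_{kQ_0}B\to L_Q$ be the linear map $a_0b_1a_1\cdots b_na_n\mapsto\sigma(a_0)\tau(b_1)\sigma(a_1)\cdots\tau(b_n)\sigma(a_n)$, $a_i\in\Lambda^q(Q)$, $b_i\in\overline{B}$. The quadruple $(L_Q,r,\sigma,B)$ satisfies the strong free product property if $\sigma'$ is a linear isomorphism. A dg-algebra is formal if it is quasi-isomorphic (through dg-algebra quasi-isomorphisms) to its homology with zero differential. *)

(* Defs.v *)
From HB Require Import structures.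
From mathcomp Require Import all_boot all_order all_algebra zify.
From mathcomp Require Import boolp.
From Stdlib Require Import Relations.Relation_Operators.

Set Implicit Arguments.
Unset Strict Implicit.
Unset Printing Implicit Defensive.

Import Order.TTheory GRing.Theory Num.Theory.
Local Open Scope ring_scope.
Local Open Scope quotient_scope.

(* Algebras over kI = \bigoplus_(i in I) k e_i, represented as {ffun I -> k} with
   pointwise product. The zero algebra is allowed (Lambda^q(Q) can vanish), so the
   underlying structure is pzRingType rather than the nontrivial algType. The
   image of kI need not be central, only that of the constants k. *)
HB.mixin Record PzRing_isVertexAlgebra (k : fieldType) (I : finType) A
    of GRing.PzRing A := {
  base : {ffun I -> k} -> A;
  base_zmod_morphism : zmod_morphism base;
  base_monoid_morphism : monoid_morphism base;
  base_central : forall (c : k) (a : A),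
    base [ffun => c] * a = a * base [ffun => c]
}.

#[short(type="vAlgType")]
HB.structure Definition VertexAlgebra (k : fieldType) (I : finType) :=
  { A of GRing.PzRing A & PzRing_isVertexAlgebra k I A }.

Arguments base {k I s} _ : rename.

HB.instance Definition _ (k : fieldType) (I : finType) (A : vAlgType k I) :=
  GRing.isZmodMorphism.Build {ffun I -> k} A (@base k I A) base_zmod_morphism.
HB.instance Definition _ (k : fieldType) (I : finType) (A : vAlgType k I) :=
  GRing.isMonoidMorphism.Build {ffun I -> k} A (@base k I A)
    base_monoid_morphism.

Fact ffun_base_central (k : fieldType) (I : finType) (c : k)
    (a : {ffun I -> k}) : idfun [ffun => c] * a = a * idfun [ffun => c].
Proof. by apply/ffunP => i; rewrite !ffunE mulrC. Qed.
HB.instance Definition _ (k : fieldType) (I : finType) :=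
  PzRing_isVertexAlgebra.Build k I {ffun I -> k}
    (fun x y : {ffun I -> k} => erefl (x - y))
    (conj erefl (fun x y : {ffun I -> k} => erefl (x * y)))
    (@ffun_base_central k I).

Definition kI (k : fieldType) (I : finType) : vAlgType k I := {ffun I -> k}.

Fact kI_mulC k I (x y : kI k I) : x * y = y * x.
Proof. by apply/ffunP => i; rewrite !ffunE mulrC. Qed.

Definition videm (k : fieldType) (I : finType) (i : I) : kI k I :=
  [ffun j => (j == i)%:R].

Record algHom (k : fieldType) (I : finType) (A B : vAlgType k I) := AlgHom {
  algHom_fun :> {rmorphism A -> B};
  algHom_base : forall s, algHom_fun (base s) = base s
}.

Definition klinear (k : fieldType) (I : finType) (A B : vAlgType k I)
    (f : A -> B) : Prop :=
  (forall x y, f (x + y) = f x + f y) /\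
  (forall (c : k) x, f (base [ffun => c] * x) = base [ffun => c] * f x).

Definition bimod_map (k : fieldType) (I : finType) (A B : vAlgType k I)
    (f : A -> B) : Prop :=
  (forall x y, f (x + y) = f x + f y) /\
  (forall s t x, f (base s * x * base t) = base s * f x * base t).

Section Subalgebra.
Variables (k : fieldType) (I : finType) (A : vAlgType k I).

Record subalgebra (P : A -> Prop) : Prop := Subalgebra {
  subalg_base : forall s, P (base s);
  subalgB : forall x y, P x -> P y -> P (x - y);
  subalgM : forall x y, P x -> P y -> P (x * y)
}.

Variables (P : A -> Prop) (HP : subalgebra P).

Definition subalg_pred of subalgebra P : pred A := fun x => `[< P x >].

Fact subalg_pred_closed : subring_closed (subalg_pred HP).
Proof.
split=> [|x y|x y]; rewrite ?unfold_in.
- by apply/asboolP; rewrite -(rmorph1 (@base k I A)); apply: subalg_base.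
- by move=> /asboolP Px /asboolP Py; apply/asboolP; apply: subalgB.
- by move=> /asboolP Px /asboolP Py; apply/asboolP; apply: subalgM.
Qed.

Record subalg_of := Subalg {
  subalg_val : A;
  subalg_valP : subalg_pred HP subalg_val
}.

HB.instance Definition _ := [isSub for subalg_val].
HB.instance Definition _ := [Choice of subalg_of by <:].
HB.instance Definition _ :=
  GRing.SubChoice_isSubPzRing.Build A (subalg_pred HP) subalg_of
    subalg_pred_closed.

Definition subalg_in (x : A) (Px : P x) : subalg_of :=
  @Subalg x (introT (asboolP (P x)) Px).

Lemma subalg_inP (x : subalg_of) : P (val x).
Proof. exact/asboolP/(valP x). Qed.

Definition subalg_base_fun (s : {ffun I -> k}) : subalg_of :=
  subalg_in (subalg_base HP s).

Fact subalg_base_zmod : zmod_morphism subalg_base_fun.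
Proof. by move=> x y; apply: val_inj; rewrite rmorphB /= rmorphB. Qed.
Fact subalg_base_monoid : monoid_morphism subalg_base_fun.
Proof.
split=> [|x y]; apply: val_inj; first by rewrite rmorph1 /= rmorph1.
by rewrite rmorphM /= rmorphM.
Qed.
Fact subalg_base_central (c : k) (a : subalg_of) :
  subalg_base_fun [ffun => c] * a = a * subalg_base_fun [ffun => c].
Proof. by apply: val_inj; rewrite !rmorphM /= base_central. Qed.

HB.instance Definition _ := PzRing_isVertexAlgebra.Build k I subalg_of
  subalg_base_zmod subalg_base_monoid subalg_base_central.

End Subalgebra.

Section Quotient.
Variables (k : fieldType) (I : finType) (A : vAlgType k I).

Record ideal (J : A -> Prop) : Prop := Ideal {
  ideal0 : J 0;
  idealD : forall x y, J x -> J y -> J (x + y);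
  idealMl : forall a x, J x -> J (a * x);
  idealMr : forall a x, J x -> J (x * a)
}.

Variables (J : A -> Prop) (HJ : ideal J).

Fact idealN x : J x -> J (- x).
Proof. by rewrite -mulN1r; apply: idealMl. Qed.

Definition ideal_eqv (_ : ideal J) (x y : A) : bool := `[< J (x - y) >].

Fact ideal_eqv_refl : reflexive (ideal_eqv HJ).
Proof. by move=> x; apply/asboolP; rewrite subrr; apply: ideal0. Qed.
Fact ideal_eqv_sym : symmetric (ideal_eqv HJ).
Proof.
by move=> x y; apply/asboolP/asboolP => /idealN; rewrite opprB.
Qed.
Fact ideal_eqv_trans : transitive (ideal_eqv HJ).
Proof.
move=> y x z /asboolP Hxy /asboolP Hyz; apply/asboolP.
by rewrite -(subrK y x) -addrA; apply: idealD.
Qed.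
Canonical ideal_equiv :=
  EquivRel (ideal_eqv HJ) ideal_eqv_refl ideal_eqv_sym ideal_eqv_trans.

Definition quot := {eq_quot (ideal_eqv HJ)}.
HB.instance Definition _ := Choice.on quot.
HB.instance Definition _ : EqQuotient A (ideal_eqv HJ) quot := EqQuotient.on quot.

Definition quot_pi (x : A) : quot := \pi_quot x.

Lemma quot_piE x y : quot_pi x = quot_pi y <-> J (x - y).
Proof. by split=> [/eqquotP/asboolP|H]; last exact/eqquotP/asboolP. Qed.
Lemma quot_reprK (x : quot) : quot_pi (repr x) = x.
Proof. exact: reprK. Qed.
Lemma quot_repr_pi x : J (repr (quot_pi x) - x).
Proof. by apply/quot_piE; rewrite quot_reprK. Qed.
Lemma quot_ind (P : quot -> Prop) : (forall x, P (quot_pi x)) -> forall x, P x.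
Proof. by move=> H x; rewrite -(quot_reprK x). Qed.

Definition quot_add (x y : quot) := quot_pi (repr x + repr y).
Definition quot_opp (x : quot) := quot_pi (- repr x).
Definition quot_mul (x y : quot) := quot_pi (repr x * repr y).

Fact quot_addE x y : quot_add (quot_pi x) (quot_pi y) = quot_pi (x + y).
Proof.
by apply/quot_piE; rewrite opprD addrACA; apply: idealD => //;
  apply: quot_repr_pi.
Qed.
Fact quot_oppE x : quot_opp (quot_pi x) = quot_pi (- x).
Proof.
by apply/quot_piE; rewrite -opprD; apply: idealN; apply: quot_repr_pi.
Qed.
Fact quot_mulE x y : quot_mul (quot_pi x) (quot_pi y) = quot_pi (x * y).
Proof.
apply/quot_piE; set x' := repr _; set y' := repr _.
have -> : x' * y' - x * y = (x' - x) * y' + x * (y' - y).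
  by rewrite mulrBl mulrBr addrA subrK.
by apply: idealD => //; [apply: idealMr|apply: idealMl] => //;
  apply: quot_repr_pi.
Qed.

Fact quot_addA : associative quot_add.
Proof.
by elim/quot_ind=> x; elim/quot_ind=> y; elim/quot_ind=> z;
  rewrite !quot_addE addrA.
Qed.
Fact quot_addC : commutative quot_add.
Proof. by elim/quot_ind=> x; elim/quot_ind=> y; rewrite !quot_addE addrC. Qed.
Fact quot_add0 : left_id (quot_pi 0) quot_add.
Proof. by elim/quot_ind=> x; rewrite quot_addE add0r. Qed.
Fact quot_addN : left_inverse (quot_pi 0) quot_opp quot_add.
Proof. by elim/quot_ind=> x; rewrite quot_oppE quot_addE addNr. Qed.
Fact quot_mulA : associative quot_mul.
Proof.
by elim/quot_ind=> x; elim/quot_ind=> y; elim/quot_ind=> z;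
  rewrite !quot_mulE mulrA.
Qed.
Fact quot_mul1 : left_id (quot_pi 1) quot_mul.
Proof. by elim/quot_ind=> x; rewrite quot_mulE mul1r. Qed.
Fact quot_1mul : right_id (quot_pi 1) quot_mul.
Proof. by elim/quot_ind=> x; rewrite quot_mulE mulr1. Qed.
Fact quot_mulDl : left_distributive quot_mul quot_add.
Proof.
by elim/quot_ind=> x; elim/quot_ind=> y; elim/quot_ind=> z;
  rewrite !(quot_mulE, quot_addE) mulrDl.
Qed.
Fact quot_mulDr : right_distributive quot_mul quot_add.
Proof.
by elim/quot_ind=> x; elim/quot_ind=> y; elim/quot_ind=> z;
  rewrite !(quot_mulE, quot_addE) mulrDr.
Qed.

HB.instance Definition _ := GRing.isPzRing.Build quot
  quot_addA quot_addC quot_add0 quot_addN quot_mulA quot_mul1 quot_1mul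
  quot_mulDl quot_mulDr.

Fact quot_pi_zmod : zmod_morphism quot_pi.
Proof. by move=> x y; rewrite -quot_addE -quot_oppE. Qed.
Fact quot_pi_monoid : monoid_morphism quot_pi.
Proof. by split=> [|x y]; rewrite -?quot_mulE. Qed.
HB.instance Definition _ := GRing.isZmodMorphism.Build A quot quot_pi
  quot_pi_zmod.
HB.instance Definition _ := GRing.isMonoidMorphism.Build A quot quot_pi
  quot_pi_monoid.

Definition quot_base (s : {ffun I -> k}) : quot := quot_pi (base s).
Fact quot_base_zmod : zmod_morphism quot_base.
Proof. by move=> x y; rewrite /quot_base !rmorphB. Qed.
Fact quot_base_monoid : monoid_morphism quot_base.
Proof. by split=> [|x y]; rewrite /quot_base ?rmorph1 ?rmorphM. Qed.
Fact quot_base_central (c : k) (a : quot) :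
  quot_base [ffun => c] * a = a * quot_base [ffun => c].
Proof.
by elim/quot_ind: a => a; rewrite /quot_base -!rmorphM base_central.
Qed.
HB.instance Definition _ := PzRing_isVertexAlgebra.Build k I quot
  quot_base_zmod quot_base_monoid quot_base_central.

Definition quot_map : algHom A quot :=
  @AlgHom k I A quot quot_pi (fun s => erefl).

End Quotient.

Section GeneratedIdeal.
Variables (k : fieldType) (I : finType) (A : vAlgType k I) (r : A).

Inductive principal : A -> Prop :=
| principal_gen : principal r
| principal0 : principal 0
| principalD x y : principal x -> principal y -> principal (x + y)
| principalMl a x : principal x -> principal (a * x)
| principalMr a x : principal x -> principal (x * a).

Lemma principal_ideal : ideal principal.
Proof.
by split; [exact: principal0|exact: principalD|exact: principalMl
          |exact: principalMr].
Qed.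

End GeneratedIdeal.

(* The algebra A<X>/(R) obtained from A by freely adjoining (noncommuting)
   elements x of X and imposing the relations u = v for R u v. Only the constants
   k are required to commute with the new elements. *)
Section Adjoin.
Variables (k : fieldType) (I : finType) (A : vAlgType k I) (X : Type).

Inductive term :=
| Cst of A
| Gen of X
| Add of term & term
| Opp of term
| Mul of term & term.

Variable R : term -> term -> Prop.

Inductive adj_eq : term -> term -> Prop :=
| AdjRel u v : R u v -> adj_eq u v
| AdjRefl u : adj_eq u u
| AdjSym u v : adj_eq u v -> adj_eq v u
| AdjTrans u v w : adj_eq u v -> adj_eq v w -> adj_eq u w
| AdjAdd u u' v v' : adj_eq u u' -> adj_eq v v' -> adj_eq (Add u v) (Add u' v')
| AdjOpp u u' : adj_eq u u' -> adj_eq (Opp u) (Opp u')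
| AdjMul u u' v v' : adj_eq u u' -> adj_eq v v' -> adj_eq (Mul u v) (Mul u' v')
| AdjAddA u v w : adj_eq (Add u (Add v w)) (Add (Add u v) w)
| AdjAddC u v : adj_eq (Add u v) (Add v u)
| AdjAdd0 u : adj_eq (Add (Cst 0) u) u
| AdjAddN u : adj_eq (Add (Opp u) u) (Cst 0)
| AdjMulA u v w : adj_eq (Mul u (Mul v w)) (Mul (Mul u v) w)
| AdjMul1 u : adj_eq (Mul (Cst 1) u) u
| Adj1Mul u : adj_eq (Mul u (Cst 1)) u
| AdjMulDl u v w : adj_eq (Mul (Add u v) w) (Add (Mul u w) (Mul v w))
| AdjMulDr u v w : adj_eq (Mul u (Add v w)) (Add (Mul u v) (Mul u w))
| AdjCstD a b : adj_eq (Cst (a + b)) (Add (Cst a) (Cst b))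
| AdjCstM a b : adj_eq (Cst (a * b)) (Mul (Cst a) (Cst b))
| AdjCentral (c : k) u :
    adj_eq (Mul (Cst (base [ffun => c])) u) (Mul u (Cst (base [ffun => c]))).

HB.instance Definition _ := gen_eqMixin term.
HB.instance Definition _ := gen_choiceMixin term.

Definition adj_eqb (u v : term) : bool := `[< adj_eq u v >].

Fact adj_eqb_refl : reflexive adj_eqb.
Proof. by move=> u; apply/asboolP; apply: AdjRefl. Qed.
Fact adj_eqb_sym : symmetric adj_eqb.
Proof. by move=> u v; apply/asboolP/asboolP; apply: AdjSym. Qed.
Fact adj_eqb_trans : transitive adj_eqb.
Proof.
by move=> v u w /asboolP Huv /asboolP Hvw; apply/asboolP; apply: AdjTrans Hvw.
Qed.
Canonical adj_equiv := EquivRel adj_eqb adj_eqb_refl adj_eqb_sym adj_eqb_trans.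

Definition adjoin := {eq_quot adj_eqb}.
HB.instance Definition _ := Choice.on adjoin.
HB.instance Definition _ : EqQuotient term adj_eqb adjoin := EqQuotient.on adjoin.

Definition adj_pi (u : term) : adjoin := \pi_adjoin u.

Lemma adj_piE u v : adj_pi u = adj_pi v <-> adj_eq u v.
Proof. by split=> [/eqquotP/asboolP|H]; last exact/eqquotP/asboolP. Qed.
Lemma adj_reprK (x : adjoin) : adj_pi (repr x) = x.
Proof. exact: reprK. Qed.
Lemma adj_repr_pi u : adj_eq (repr (adj_pi u)) u.
Proof. by apply/adj_piE; rewrite adj_reprK. Qed.
Lemma adj_pi_ind (P : adjoin -> Prop) :
  (forall u, P (adj_pi u)) -> forall x, P x.
Proof. by move=> H x; rewrite -(adj_reprK x). Qed.

Definition adj_add (x y : adjoin) := adj_pi (Add (repr x) (repr y)).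
Definition adj_opp (x : adjoin) := adj_pi (Opp (repr x)).
Definition adj_mul (x y : adjoin) := adj_pi (Mul (repr x) (repr y)).

Fact adj_addE u v : adj_add (adj_pi u) (adj_pi v) = adj_pi (Add u v).
Proof. by apply/adj_piE; apply: AdjAdd; apply: adj_repr_pi. Qed.
Fact adj_oppE u : adj_opp (adj_pi u) = adj_pi (Opp u).
Proof. by apply/adj_piE; apply: AdjOpp; apply: adj_repr_pi. Qed.
Fact adj_mulE u v : adj_mul (adj_pi u) (adj_pi v) = adj_pi (Mul u v).
Proof. by apply/adj_piE; apply: AdjMul; apply: adj_repr_pi. Qed.

Fact adj_addA : associative adj_add.
Proof.
elim/adj_pi_ind=> x; elim/adj_pi_ind=> y; elim/adj_pi_ind=> z.
by rewrite !adj_addE; apply/adj_piE; apply: AdjAddA.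
Qed.
Fact adj_addC : commutative adj_add.
Proof.
elim/adj_pi_ind=> x; elim/adj_pi_ind=> y.
by rewrite !adj_addE; apply/adj_piE; apply: AdjAddC.
Qed.
Fact adj_add0 : left_id (adj_pi (Cst 0)) adj_add.
Proof.
by elim/adj_pi_ind=> x; rewrite adj_addE; apply/adj_piE; apply: AdjAdd0.
Qed.
Fact adj_addN : left_inverse (adj_pi (Cst 0)) adj_opp adj_add.
Proof.
elim/adj_pi_ind=> x; rewrite adj_oppE adj_addE.
by apply/adj_piE; apply: AdjAddN.
Qed.
Fact adj_mulA : associative adj_mul.
Proof.
elim/adj_pi_ind=> x; elim/adj_pi_ind=> y; elim/adj_pi_ind=> z.
by rewrite !adj_mulE; apply/adj_piE; apply: AdjMulA.
Qed.
Fact adj_mul1 : left_id (adj_pi (Cst 1)) adj_mul.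
Proof.
by elim/adj_pi_ind=> x; rewrite adj_mulE; apply/adj_piE; apply: AdjMul1.
Qed.
Fact adj_1mul : right_id (adj_pi (Cst 1)) adj_mul.
Proof.
by elim/adj_pi_ind=> x; rewrite adj_mulE; apply/adj_piE; apply: Adj1Mul.
Qed.
Fact adj_mulDl : left_distributive adj_mul adj_add.
Proof.
elim/adj_pi_ind=> x; elim/adj_pi_ind=> y; elim/adj_pi_ind=> z.
by rewrite !(adj_addE, adj_mulE); apply/adj_piE; apply: AdjMulDl.
Qed.
Fact adj_mulDr : right_distributive adj_mul adj_add.
Proof.
elim/adj_pi_ind=> x; elim/adj_pi_ind=> y; elim/adj_pi_ind=> z.
by rewrite !(adj_addE, adj_mulE); apply/adj_piE; apply: AdjMulDr.
Qed.

HB.instance Definition _ := GRing.isPzRing.Build adjoin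
  adj_addA adj_addC adj_add0 adj_addN adj_mulA adj_mul1 adj_1mul
  adj_mulDl adj_mulDr.

Definition adj_gen (x : X) : adjoin := adj_pi (Gen x).
Definition adj_cst (a : A) : adjoin := adj_pi (Cst a).

Lemma adj_piD u v : adj_pi (Add u v) = adj_pi u + adj_pi v.
Proof. by rewrite -adj_addE. Qed.
Lemma adj_piM u v : adj_pi (Mul u v) = adj_pi u * adj_pi v.
Proof. by rewrite -adj_mulE. Qed.
Lemma adj_piN u : adj_pi (Opp u) = - adj_pi u.
Proof. by rewrite -adj_oppE. Qed.

Fact adj_cst_zmod : zmod_morphism adj_cst.
Proof.
have D a b : adj_cst (a + b) = adj_cst a + adj_cst b.
  by rewrite /adj_cst -adj_piD; apply/adj_piE; apply: AdjCstD.
by move=> a b; apply: (addIr (adj_cst b)); rewrite -D !subrK.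
Qed.
Fact adj_cst_monoid : monoid_morphism adj_cst.
Proof.
split=> [//|a b]; rewrite /adj_cst -adj_piM.
by apply/adj_piE; apply: AdjCstM.
Qed.
HB.instance Definition _ := GRing.isZmodMorphism.Build A adjoin adj_cst
  adj_cst_zmod.
HB.instance Definition _ := GRing.isMonoidMorphism.Build A adjoin adj_cst
  adj_cst_monoid.

Definition adj_base (s : {ffun I -> k}) : adjoin := adj_cst (base s).
Fact adj_base_zmod : zmod_morphism adj_base.
Proof. by move=> x y; rewrite /adj_base !rmorphB. Qed.
Fact adj_base_monoid : monoid_morphism adj_base.
Proof. by split=> [|x y]; rewrite /adj_base ?rmorph1 ?rmorphM. Qed.
Fact adj_base_central (c : k) (a : adjoin) :
  adj_base [ffun => c] * a = a * adj_base [ffun => c].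
Proof.
elim/adj_pi_ind: a => u; rewrite /adj_base /adj_cst -!adj_piM.
by apply/adj_piE; apply: AdjCentral.
Qed.
HB.instance Definition _ := PzRing_isVertexAlgebra.Build k I adjoin
  adj_base_zmod adj_base_monoid adj_base_central.

Definition adj_in : algHom A adjoin :=
  @AlgHom k I A adjoin adj_cst (fun s => erefl).

Lemma adjoin_ind (P : adjoin -> Prop) :
  (forall a, P (adj_cst a)) -> (forall x, P (adj_gen x)) ->
  (forall x y, P x -> P y -> P (x + y)) -> (forall x, P x -> P (- x)) ->
  (forall x y, P x -> P y -> P (x * y)) -> forall x, P x.
Proof.
move=> Pc Pg PD PN PM; elim/adj_pi_ind.
elim=> [a|x|u Pu v Pv|u Pu|u Pu v Pv].
- exact: Pc.
- exact: Pg.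
- by rewrite adj_piD; apply: PD.
- by rewrite adj_piN; apply: PN.
- by rewrite adj_piM; apply: PM.
Qed.

Section Lift.
Variables (B : vAlgType k I) (f : algHom A B) (g : X -> B).

Fixpoint eval (u : term) : B :=
  match u with
  | Cst a => f a
  | Gen x => g x
  | Add u v => eval u + eval v
  | Opp u => - eval u
  | Mul u v => eval u * eval v
  end.

Hypothesis HR : forall u v, R u v -> eval u = eval v.

Fact eval_eq u v : adj_eq u v -> eval u = eval v.
Proof.
elim=> {u v} /=.
- exact: HR.
- by [].
- by move=> u v _ ->.
- by move=> u v w _ -> _ ->.
- by move=> u u' v v' _ -> _ ->.
- by move=> u u' _ ->.
- by move=> u u' v v' _ -> _ ->.
- by move=> u v w; rewrite addrA.
- by move=> u v; rewrite addrC.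
- by move=> u; rewrite rmorph0 add0r.
- by move=> u; rewrite rmorph0 addNr.
- by move=> u v w; rewrite mulrA.
- by move=> u; rewrite rmorph1 mul1r.
- by move=> u; rewrite rmorph1 mulr1.
- by move=> u v w; rewrite mulrDl.
- by move=> u v w; rewrite mulrDr.
- by move=> a b; rewrite rmorphD.
- by move=> a b; rewrite rmorphM.
- by move=> c u; rewrite algHom_base base_central.
Qed.

Definition adj_lift_fun of (forall u v, R u v -> eval u = eval v) :=
  fun x : adjoin => eval (repr x).

Let h := adj_lift_fun HR.

Lemma adj_lift_pi u : h (adj_pi u) = eval u.
Proof. exact: eval_eq (adj_repr_pi u). Qed.

Fact adj_lift_zmod : zmod_morphism h.
Proof.
elim/adj_pi_ind=> x; elim/adj_pi_ind=> y.
by rewrite -adj_piN -adj_piD !adj_lift_pi.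
Qed.
Fact adj_lift_monoid : monoid_morphism h.
Proof.
split=> [|]; first by rewrite -[1]/(adj_pi (Cst 1)) adj_lift_pi /= rmorph1.
elim/adj_pi_ind=> x; elim/adj_pi_ind=> y.
by rewrite -adj_piM !adj_lift_pi.
Qed.
HB.instance Definition _ := GRing.isZmodMorphism.Build adjoin B
  (adj_lift_fun HR) adj_lift_zmod.
HB.instance Definition _ := GRing.isMonoidMorphism.Build adjoin B
  (adj_lift_fun HR) adj_lift_monoid.

Fact adj_lift_base s : adj_lift_fun HR (base s) = base s.
Proof.
by rewrite -[base s]/(adj_pi (Cst (base s))) [LHS]adj_lift_pi /= algHom_base.
Qed.

Definition adj_lift : algHom adjoin B :=
  @AlgHom k I adjoin B (adj_lift_fun HR) adj_lift_base.

Lemma adj_lift_cst a : adj_lift (adj_cst a) = f a.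
Proof. exact: adj_lift_pi. Qed.
Lemma adj_lift_gen x : adj_lift (adj_gen x) = g x.
Proof. exact: adj_lift_pi. Qed.

End Lift.
End Adjoin.

Arguments term {k I} A X.
Arguments Cst {k I A X}.
Arguments Gen {k I A X}.

(* Universal localization A[(f x)^{-1}]_{x in X}. *)
Inductive loc_rel (k : fieldType) (I : finType) (A : vAlgType k I) (X : Type)
    (f : X -> A) : term A X -> term A X -> Prop :=
| LocL x : loc_rel f (Mul (Gen x) (Cst (f x))) (Cst 1)
| LocR x : loc_rel f (Mul (Cst (f x)) (Gen x)) (Cst 1).

Definition localize (k : fieldType) (I : finType) (A : vAlgType k I) (X : Type)
    (f : X -> A) : vAlgType k I := adjoin (loc_rel f).

(* A *_{kI} B, presented as A with the elements of B adjoined subject to the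
   relations holding in B and the identification of the two copies of kI. *)
Section FreeProduct.
Variables (k : fieldType) (I : finType) (A B : vAlgType k I).

Inductive freeprod_rel : term A B -> term A B -> Prop :=
| FpD b c : freeprod_rel (Gen (b + c)) (Add (Gen b) (Gen c))
| FpM b c : freeprod_rel (Gen (b * c)) (Mul (Gen b) (Gen c))
| FpBase s : freeprod_rel (Gen (base s)) (Cst (base s)).

Definition freeprod : vAlgType k I := adjoin freeprod_rel.

Definition fpl : algHom A freeprod := adj_in freeprod_rel.

Definition fpr_fun (b : B) : freeprod := adj_gen freeprod_rel b.

Fact fpr_zmod : zmod_morphism fpr_fun.
Proof.
have D b c : fpr_fun (b + c) = fpr_fun b + fpr_fun c.
  rewrite /fpr_fun /adj_gen -adj_piD; apply/adj_piE.
  by apply: AdjRel; apply: FpD.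
by move=> a b; apply: (addIr (fpr_fun b)); rewrite -D !subrK.
Qed.
Fact fpr_base s : fpr_fun (base s) = base s.
Proof. by apply/adj_piE; apply: AdjRel; apply: FpBase. Qed.
Fact fpr_monoid : monoid_morphism fpr_fun.
Proof.
split=> [|b c]; first by rewrite -(rmorph1 (@base k I B)) fpr_base rmorph1.
by rewrite /fpr_fun /adj_gen -adj_piM; apply/adj_piE; apply: AdjRel; apply: FpM.
Qed.
HB.instance Definition _ := GRing.isZmodMorphism.Build B freeprod fpr_fun
  fpr_zmod.
HB.instance Definition _ := GRing.isMonoidMorphism.Build B freeprod fpr_fun
  fpr_monoid.

Definition fpr : algHom B freeprod := @AlgHom k I B freeprod fpr_fun fpr_base.

Section FpLift.
Variables (C : vAlgType k I) (f : algHom A C) (g : algHom B C).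

Fact fp_lift_rel (u v : term A B) :
  freeprod_rel u v -> eval f g u = eval f g v.
Proof.
by case=> [b c|b c|s] /=; rewrite ?rmorphD ?rmorphM ?algHom_base.
Qed.

Definition fp_lift : algHom freeprod C := adj_lift fp_lift_rel.

Lemma fp_lift_l a : fp_lift (fpl a) = f a.
Proof. exact: adj_lift_cst. Qed.
Lemma fp_lift_r b : fp_lift (fpr b) = g b.
Proof. exact: adj_lift_gen. Qed.
End FpLift.

Lemma freeprod_ind (P : freeprod -> Prop) :
  (forall a, P (fpl a)) -> (forall b, P (fpr b)) ->
  (forall x y, P x -> P y -> P (x + y)) -> (forall x, P x -> P (- x)) ->
  (forall x y, P x -> P y -> P (x * y)) -> forall x, P x.
Proof. exact: adjoin_ind. Qed.

End FreeProduct.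

(* kI[t], with t commuting with the e_i. *)
Section Polynomials.
Variables (k : fieldType) (I : finType).

Inductive poly_rel : term (kI k I) unit -> term (kI k I) unit -> Prop :=
| PolyComm s : poly_rel (Mul (Cst s) (Gen tt)) (Mul (Gen tt) (Cst s)).

Definition kIpoly : vAlgType k I := adjoin poly_rel.
Definition kIvar : kIpoly := adj_gen poly_rel tt.

Definition kIpoly_in : algHom (kI k I) kIpoly := adj_in poly_rel.

Lemma kIvar_comm s : base s * kIvar = kIvar * base s.
Proof.
rewrite -[base s]/(adj_pi poly_rel (Cst s)) /kIvar /adj_gen -!adj_piM.
by apply/adj_piE; apply: AdjRel; apply: PolyComm.
Qed.

Section PolyLift.
Variables (C : vAlgType k I) (r : C).
Hypothesis Hr : forall s, base s * r = r * base s.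

Definition base_hom : algHom (kI k I) C :=
  @AlgHom k I (kI k I) C (@base k I C) (fun s => erefl).

Fact poly_lift_rel (u v : term (kI k I) unit) :
  poly_rel u v -> eval base_hom (fun=> r) u = eval base_hom (fun=> r) v.
Proof. by case=> s /=; apply: Hr. Qed.

Definition poly_lift : algHom kIpoly C := adj_lift poly_lift_rel.

Lemma poly_lift_var : poly_lift kIvar = r.
Proof. exact: adj_lift_gen. Qed.
End PolyLift.
End Polynomials.

Record quiver := Quiver {
  vertex : finType;
  arrow : finType;
  qtail : arrow -> vertex;
  qhead : arrow -> vertex
}.

Definition doubleQ (Q : quiver) : quiver :=
  @Quiver (vertex Q) (arrow Q + arrow Q)%type
    (fun a => match a with inl a => qtail a | inr a => qhead a end)
    (fun a => match a with inl a => qhead a | inr a => qtail a end).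

Definition star (Q : quiver) (a : arrow (doubleQ Q)) : arrow (doubleQ Q) :=
  match a with inl a => inr a | inr a => inl a end.

(* The path algebra. A path is the product of its arrows from left to right, so
   a b is nonzero only if the head of a is the tail of b. *)
Inductive path_rel (k : fieldType) (Q : quiver) :
    term (kI k (vertex Q)) (arrow Q) ->
    term (kI k (vertex Q)) (arrow Q) -> Prop :=
| PathArrow a :
    path_rel (Mul (Mul (Cst (videm k (qtail a))) (Gen a)) (Cst (videm k (qhead a))))
             (Gen a).

Definition pathAlg (k : fieldType) (Q : quiver) : vAlgType k (vertex Q) :=
  adjoin (@path_rel k Q).

Definition path_arrow (k : fieldType) (Q : quiver) (a : arrow Q) : pathAlg k Q :=
  adj_gen (@path_rel k Q) a.

Definition is_total_order (T : eqType) (le : rel T) : Prop :=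
  [/\ reflexive le, antisymmetric le, transitive le & total le].

Section Multiplicative.
Variables (k : fieldType) (Q : quiver).
Local Notation I := (vertex Q).

Definition one_plus (a : arrow (doubleQ Q)) : pathAlg k (doubleQ Q) :=
  1 + path_arrow k a * path_arrow k (star a).

Definition LQ : vAlgType k I := localize one_plus.

Definition lq_elt (a : arrow (doubleQ Q)) : LQ := adj_cst (loc_rel one_plus) (one_plus a).
Definition lq_inv (a : arrow (doubleQ Q)) : LQ := adj_gen (loc_rel one_plus) a.

Lemma lq_mulVr a : lq_inv a * lq_elt a = 1.
Proof.
by rewrite /lq_inv /lq_elt /adj_gen /adj_cst -adj_piM; apply/adj_piE;
  apply: AdjRel; apply: LocL.
Qed.
Lemma lq_mulrV a : lq_elt a * lq_inv a = 1.
Proof.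
by rewrite /lq_inv /lq_elt /adj_gen /adj_cst -adj_piM; apply/adj_piE;
  apply: AdjRel; apply: LocR.
Qed.

(* (1 + a a^* )^{epsilon(a)} *)
Definition rho_factor (a : arrow (doubleQ Q)) : LQ :=
  match a with inl _ => lq_elt a | inr _ => lq_inv a end.
Definition rho_cofactor (a : arrow (doubleQ Q)) : LQ :=
  match a with inl _ => lq_inv a | inr _ => lq_elt a end.

Variable le : rel (arrow (doubleQ Q)).
Definition ordered_arrows := sort le (enum (arrow (doubleQ Q))).

Definition rho : LQ := \prod_(a <- ordered_arrows) rho_factor a.
Definition rho_inv : LQ := \prod_(a <- rev ordered_arrows) rho_cofactor a.

Lemma rho_mulrV : rho * rho_inv = 1.
Proof.
rewrite /rho /rho_inv; elim: ordered_arrows => [|a s IH]; first by rewrite /rev /= !big_nil mul1r.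
rewrite rev_cons -cats1 big_cat big_seq1 big_cons /= mulrA -(mulrA (rho_factor a)) IH mulr1.
by case: a => a; rewrite /= ?lq_mulrV ?lq_mulVr.
Qed.
Lemma rho_mulVr : rho_inv * rho = 1.
Proof.
rewrite /rho /rho_inv; elim: ordered_arrows => [|a s IH]; first by rewrite /rev /= !big_nil mul1r.
rewrite rev_cons -cats1 big_cat big_seq1 big_cons /= mulrA -(mulrA _ (rho_cofactor a)).
have -> : rho_cofactor a * rho_factor a = 1.
  by case: a => a; rewrite /= ?lq_mulrV ?lq_mulVr.
by rewrite mulr1.
Qed.

Lemma arrow_idem (a : arrow (doubleQ Q)) :
  base (videm k (qtail a)) * path_arrow k a * base (videm k (qhead a))
  = path_arrow k a.
Proof.
have := (adj_piE _ _ _).2 (AdjRel (@PathArrow k (doubleQ Q) a)).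
by rewrite !adj_piM.
Qed.

Lemma ffun_videm (s : {ffun I -> k}) i : s * videm k i = [ffun => s i] * videm k i.
Proof.
apply/ffunP => j; rewrite !ffunE.
by have [->|] := eqVneq j i; rewrite ?mulr0.
Qed.

Lemma base_one_plus s a : base s * one_plus a = one_plus a * base s.
Proof.
rewrite mulrDl mulrDr mul1r mulr1; congr (_ + _).
set p := path_arrow k a; set p' := path_arrow k (star a).
have hp : base (videm k (qtail a)) * p = p.
  rewrite /p -arrow_idem !mulrA -rmorphM.
  by congr (base _ * _ * _); apply/ffunP=> j; rewrite !ffunE -natrM mulnb andbb.
have hp' : p' * base (videm k (qtail a)) = p'.
  have -> : qtail a = qhead (star a) by case: (a).
  rewrite /p' -arrow_idem -!mulrA -rmorphM.
  by congr (_ * (_ * base _)); apply/ffunP=> j; rewrite !ffunE -natrM mulnb andbb.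
transitivity (base [ffun => s (qtail a)] * (p * p')).
  by rewrite -hp !mulrA -!rmorphM ffun_videm.
rewrite base_central -hp' -!mulrA; congr (_ * (_ * _)).
rewrite -!rmorphM; congr base; apply/ffunP => j; rewrite !ffunE.
by have [->|] := eqVneq j (qtail a); rewrite ?mul0r.
Qed.

Lemma base_lq_elt s a : base s * lq_elt a = lq_elt a * base s.
Proof.
rewrite -[base s in LHS](algHom_base (adj_in (loc_rel one_plus))).
rewrite -[base s in RHS](algHom_base (adj_in (loc_rel one_plus))) /=.
by rewrite /lq_elt -!rmorphM base_one_plus.
Qed.

Lemma base_lq_inv s a : base s * lq_inv a = lq_inv a * base s.
Proof.
rewrite -[LHS]mul1r -(lq_mulVr a) -!mulrA; congr (_ * _).
by rewrite mulrA -base_lq_elt -mulrA lq_mulrV mulr1.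
Qed.

Lemma base_rho s : base s * rho = rho * base s.
Proof.
rewrite /rho; elim: ordered_arrows => [|a t IH]; first by rewrite big_nil mul1r mulr1.
rewrite big_cons -mulrA -IH !mulrA; congr (_ * _).
by case: a => a /=; rewrite ?base_lq_elt ?base_lq_inv.
Qed.

Variable q : {ffun I -> k}.

Definition rel_elt : LQ := rho - base q.

Definition preproj : vAlgType k I := quot (principal_ideal rel_elt).
Definition preproj_pi : algHom LQ preproj := quot_map (principal_ideal rel_elt).

(* B = kQ_0[t, (q+t)^{-1}] *)
Definition Bq_den (_ : unit) : kIpoly k I := base q + kIvar k I.
Definition Bq : vAlgType k I := localize Bq_den.
Definition Bq_t : Bq := adj_cst (loc_rel Bq_den) (kIvar k I).

Fact base_rel_elt s : base s * rel_elt = rel_elt * base s.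
Proof.
rewrite /rel_elt mulrBr mulrBl base_rho; congr (_ - _).
by rewrite -!rmorphM; congr base; apply: kI_mulC.
Qed.

Fact tau_rel (u v : term (kIpoly k I) unit) : loc_rel Bq_den u v ->
  eval (poly_lift base_rel_elt) (fun=> rho_inv) u
  = eval (poly_lift base_rel_elt) (fun=> rho_inv) v.
Proof.
have E : poly_lift base_rel_elt (Bq_den tt) = rho.
  rewrite rmorphD poly_lift_var; have -> := algHom_base (poly_lift base_rel_elt) q.
  by rewrite /rel_elt addrC subrK.
by case=> -[] /=; rewrite rmorph1 -[LHS]/(_ * _) E ?rho_mulrV ?rho_mulVr.
Qed.

Definition tau : algHom Bq LQ := adj_lift tau_rel.

Lemma tau_t : tau Bq_t = rel_elt.
Proof. by rewrite /tau /Bq_t adj_lift_cst poly_lift_var. Qed.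

Definition is_section (sigma : preproj -> LQ) : Prop :=
  [/\ bimod_map sigma, forall x, preproj_pi (sigma x) = x & sigma 1 = 1].

(* The words a_0 b_1 a_1 ... b_n a_n span the free product over kQ_0, so the
   formula determines sigma' among linear maps. *)
Definition sigma_prime (sigma : preproj -> LQ)
    (sigma' : freeprod preproj Bq -> LQ) : Prop :=
  klinear sigma' /\
  forall (a0 : preproj) (w : seq (Bq * preproj)),
    (forall p, p \in w -> exists b, p.1 = Bq_t * b) ->
    sigma' (fpl preproj Bq a0
            * \prod_(p <- w) (fpr preproj Bq p.1 * fpl preproj Bq p.2))
    = sigma a0 * \prod_(p <- w) (tau p.1 * sigma p.2).

Definition strong_free_product (sigma : preproj -> LQ) : Prop :=
  is_section sigma /\
  exists sigma' : freeprod preproj Bq -> LQ,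
    sigma_prime sigma sigma' /\ bijective sigma'.

End Multiplicative.

(* Cohomological grading: d has degree +1. A family of additive subgroups A_n with
   A = \bigoplus_n A_n encodes the grading; kI sits in degree 0 and is killed by d,
   so that the A_n are kI-subbimodules and d is kI-linear. *)
Record dgAlg (k : fieldType) (I : finType) := DgAlg {
  dg_alg :> vAlgType k I;
  dg_deg : int -> dg_alg -> Prop;
  dg_d : dg_alg -> dg_alg;
  dg_deg0 : forall n, dg_deg n 0;
  dg_degB : forall n x y, dg_deg n x -> dg_deg n y -> dg_deg n (x - y);
  dg_deg_base : forall s, dg_deg 0 (base s);
  dg_degM : forall m n x y, dg_deg m x -> dg_deg n y -> dg_deg (m + n) (x * y);
  dg_deg_sum : forall x, exists (s : seq int) (f : int -> dg_alg),
    [/\ uniq s, forall n, dg_deg n (f n) & x = \sum_(n <- s) f n];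
  dg_deg_direct : forall (s : seq int) (f : int -> dg_alg), uniq s ->
    (forall n, dg_deg n (f n)) -> \sum_(n <- s) f n = 0 ->
    forall n, n \in s -> f n = 0;
  dg_dD : forall x y, dg_d (x + y) = dg_d x + dg_d y;
  dg_d_base : forall s, dg_d (base s) = 0;
  dg_d_deg : forall n x, dg_deg n x -> dg_deg (n + 1) (dg_d x);
  dg_leibniz : forall n x y, dg_deg n x ->
    dg_d (x * y) = dg_d x * y + (-1) ^+ absz n * (x * dg_d y);
  dg_dd : forall x, dg_d (dg_d x) = 0
}.

Arguments dg_deg {k I} A n x : rename.
Arguments dg_d {k I} A x : rename.

Record dgHom (k : fieldType) (I : finType) (A B : dgAlg k I) := DgHom {
  dgHom_alg :> algHom A B;
  dgHom_deg : forall n x, dg_deg A n x -> dg_deg B n (dgHom_alg x);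
  dgHom_d : forall x, dgHom_alg (dg_d A x) = dg_d B (dgHom_alg x)
}.

Section Homology.
Variables (k : fieldType) (I : finType) (A : dgAlg k I).

Lemma dg_d0 : dg_d A 0 = 0.
Proof. by apply: (addrI (dg_d A 0)); rewrite -dg_dD !addr0. Qed.
Lemma dg_dN x : dg_d A (- x) = - dg_d A x.
Proof. by apply/eqP; rewrite -addr_eq0 -dg_dD addNr dg_d0. Qed.
Lemma dg_dB x y : dg_d A (x - y) = dg_d A x - dg_d A y.
Proof. by rewrite dg_dD dg_dN. Qed.
Lemma dg_d_sum (s : seq int) (f : int -> A) :
  dg_d A (\sum_(n <- s) f n) = \sum_(n <- s) dg_d A (f n).
Proof. exact: (big_morph _ (@dg_dD _ _ A) dg_d0). Qed.

Lemma dg_d1 : dg_d A 1 = 0.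
Proof. by rewrite -(rmorph1 (@base k I A)) dg_d_base. Qed.
Lemma dg_deg1 : dg_deg A 0 1.
Proof. by rewrite -(rmorph1 (@base k I A)); apply: dg_deg_base. Qed.
Lemma dg_degN n x : dg_deg A n x -> dg_deg A n (- x).
Proof. by rewrite -sub0r; apply/dg_degB/dg_deg0. Qed.
Lemma dg_degD n x y : dg_deg A n x -> dg_deg A n y -> dg_deg A n (x + y).
Proof. by move=> Hx /dg_degN Hy; rewrite -(opprK y); apply: dg_degB. Qed.

Lemma dg_d_dirsum (s : seq int) (f : int -> A) : uniq s ->
  (forall n, dg_deg A n (f n)) -> dg_d A (\sum_(n <- s) f n) = 0 ->
  forall n, n \in s -> dg_d A (f n) = 0.
Proof.
move=> us Hf; rewrite dg_d_sum => E n ns.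
pose g m := dg_d A (f (m - 1)).
have Eg : \sum_(m <- [seq m + 1 | m <- s]) g m = 0.
  rewrite big_map -[RHS]E; apply: eq_bigr => m _; by rewrite /g addrK.
have us' : uniq [seq m + 1 | m <- s] by rewrite map_inj_uniq //; apply: addIr.
have Hg m : dg_deg A m (g m) by rewrite -[m in dg_deg A m](subrK 1); apply: dg_d_deg.
by have := dg_deg_direct us' Hg Eg (map_f _ ns); rewrite /g addrK.
Qed.

Definition cycle (x : A) : Prop := dg_d A x = 0.

Lemma cycle_subalg : subalgebra cycle.
Proof.
split=> [s|x y|x y]; rewrite /cycle.
- exact: dg_d_base.
- by move=> Hx Hy; rewrite dg_dB Hx Hy subr0.
- have [s [f [us Hf ->]]] := dg_deg_sum x.
  move=> Hx Hy; rewrite mulr_suml (big_morph _ (@dg_dD _ _ A) dg_d0) big1_seq // => n /andP[_ ns].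
  by rewrite (dg_leibniz _ (Hf n)) Hy !mulr0 addr0 (dg_d_dirsum us Hf Hx ns) mul0r.
Qed.

Definition cycles : vAlgType k I := subalg_of cycle_subalg.

Definition boundary (z : cycles) : Prop := exists y, val z = dg_d A y.

Lemma boundary_ideal : ideal boundary.
Proof.
split.
- by exists 0; rewrite dg_d0.
- by move=> x y [x' Ex] [y' Ey]; exists (x' + y'); rewrite dg_dD -Ex -Ey.
- move=> a z [y Ey]; have Ha : dg_d A (val a) = 0 := subalg_inP a.
  have [s [f [us Hf Ea]]] := dg_deg_sum (val a).
  rewrite Ea in Ha; exists (\sum_(n <- s) (-1) ^+ absz n * (f n * y)).
  rewrite dg_d_sum rmorphM /= Ea Ey mulr_suml; apply: eq_big_seq => n ns.
  have H1 : dg_deg A 0 ((-1) ^+ absz n).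
    elim: (absz n) => [|m IH]; first exact: dg_deg1.
    by rewrite exprS -(addr0 0); apply: dg_degM IH; apply/dg_degN/dg_deg1.
  have H2 : dg_d A ((-1) ^+ absz n) = 0.
    by rewrite -signr_odd; case: odd; rewrite ?expr1 ?expr0 ?dg_dN dg_d1 ?oppr0.
  rewrite (dg_leibniz _ H1) H2 mul0r add0r expr0 mul1r (dg_leibniz _ (Hf n)).
  by rewrite (dg_d_dirsum us Hf Ha ns) mul0r add0r mulrA -expr2 sqrr_sign mul1r.
- move=> a z [y Ey]; have Ha : dg_d A (val a) = 0 := subalg_inP a.
  exists (y * val a); have [s [f [us Hf E]]] := dg_deg_sum y.
  rewrite rmorphM /= Ey E mulr_suml !dg_d_sum mulr_suml.
  apply: eq_bigr => n _; rewrite (dg_leibniz _ (Hf n)).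
  by rewrite Ha !mulr0 addr0.
Qed.

Definition hom_alg : vAlgType k I := quot boundary_ideal.

Definition hom_class (z : cycles) : hom_alg := quot_pi boundary_ideal z.

Definition hom_deg (n : int) (x : hom_alg) : Prop :=
  exists z : cycles, dg_deg A n (val z) /\ x = hom_class z.

Fact hom_deg0 n : hom_deg n 0.
Proof. by exists 0; split; rewrite /hom_class ?rmorph0; first exact: dg_deg0. Qed.
Fact hom_degB n x y : hom_deg n x -> hom_deg n y -> hom_deg n (x - y).
Proof.
move=> [z [Hz ->]] [w [Hw ->]]; exists (z - w).
by split; [rewrite rmorphB; apply: dg_degB|rewrite /hom_class rmorphB].
Qed.
Fact hom_deg_base s : hom_deg 0 (base s).
Proof. by exists (base s); split=> //; apply: dg_deg_base. Qed.
Fact hom_degM m n x y : hom_deg m x -> hom_deg n y -> hom_deg (m + n) (x * y).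
Proof.
move=> [z [Hz ->]] [w [Hw ->]]; exists (z * w).
by split; [rewrite rmorphM; apply: dg_degM|rewrite /hom_class rmorphM].
Qed.

Lemma val_sum (s : seq int) (g : int -> cycles) :
  val (\sum_(n <- s) g n) = \sum_(n <- s) val (g n).
Proof. exact: raddf_sum. Qed.

Fact hom_deg_sum (x : hom_alg) : exists (s : seq int) (f : int -> hom_alg),
  [/\ uniq s, forall n, hom_deg n (f n) & x = \sum_(n <- s) f n].
Proof.
elim/quot_ind: x => z; have [s [f [us Hf E]]] := dg_deg_sum (val z).
have Hz : dg_d A (\sum_(n <- s) f n) = 0 by rewrite -E; apply: (subalg_inP z).
pose f' n := if n \in s then f n else 0.
have Hf' n : cycle (f' n).
  by rewrite /f'; case: ifP => [ns|_]; [exact: dg_d_dirsum Hz _ ns|exact: dg_d0].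
pose g n : cycles := subalg_in cycle_subalg (Hf' n).
exists s, (fun n => hom_class (g n)); split=> //.
- move=> n; exists (g n); split=> //=; rewrite /f'.
  by case: ifP => _; [exact: Hf|exact: dg_deg0].
- rewrite -[RHS](raddf_sum (quot_pi boundary_ideal)); congr (quot_pi _ _).
  apply: val_inj; rewrite val_sum E; apply: eq_big_seq => n ns.
  by rewrite /= /f' ns.
Qed.

Fact hom_deg_direct (s : seq int) (f : int -> hom_alg) : uniq s ->
  (forall n, hom_deg n (f n)) -> \sum_(n <- s) f n = 0 ->
  forall n, n \in s -> f n = 0.
Proof.
move=> us Hf E.
pose g n : cycles := sval (cid (Hf n)).
have Hg n : dg_deg A n (val (g n)) /\ f n = hom_class (g n).
  exact: (svalP (cid (Hf n))).
have : boundary (\sum_(n <- s) g n - 0).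
  apply/(quot_piE boundary_ideal); rewrite (rmorph0 (quot_pi boundary_ideal)) -[RHS]E raddf_sum; apply: eq_bigr => n _.
  by case: (Hg n).
rewrite subr0 => -[y]; rewrite val_sum.
have [t [h [ut Hh ->]]] := dg_deg_sum y; rewrite dg_d_sum => E'.
pose h' n := if n - 1 \in t then dg_d A (h (n - 1)) else 0.
pose g' n := if n \in s then val (g n) else 0.
have Hh' n : dg_deg A n (h' n).
  rewrite /h'; case: ifP => _; last exact: dg_deg0.
  by rewrite -[n in dg_deg A n](subrK 1); apply: dg_d_deg.
have Hg' n : dg_deg A n (g' n).
  by rewrite /g'; case: ifP => _; [case: (Hg n)|exact: dg_deg0].
pose u := undup (s ++ [seq n + 1 | n <- t]).
have ext (v : seq int) (p : int -> A) : uniq v -> {subset v <= u} ->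
    (forall n, n \notin v -> p n = 0) -> \sum_(n <- u) p n = \sum_(n <- v) p n.
  move=> uv sv Hp; rewrite (bigID (mem v)) /= [X in _ + X]big1_seq ?addr0; last first.
    by move=> n /andP[/Hp].
  rewrite -big_filter; apply: perm_big; apply: uniq_perm => //.
    by rewrite filter_uniq ?undup_uniq.
  by move=> n; rewrite mem_filter; apply/andP/idP => [[]|nv] //; split=> //; apply: sv.
have Eu : \sum_(n <- u) (g' n - h' n) = 0.
  rewrite sumrB (ext s) //; last first.
  - by move=> n /negPf ns; rewrite /g' ns.
  - by move=> n ns; rewrite mem_undup mem_cat ns.
  rewrite (ext [seq n + 1 | n <- t]); last first.
  - move=> n nt; rewrite /h'; case: ifP => // nt'.
    by case/negP: nt; apply/mapP; exists (n - 1); rewrite ?subrK.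
  - by move=> n nt; rewrite mem_undup mem_cat nt orbT.
  - by rewrite map_inj_uniq //; apply: addIr.
  rewrite big_map; apply/eqP; rewrite subr_eq0; apply/eqP.
  transitivity (\sum_(n <- s) val (g n)).
    by apply: eq_big_seq => n ns; rewrite /g' ns.
  by rewrite E'; apply: eq_big_seq => n nt; rewrite /h' addrK nt.
move=> n ns; have [_ ->] := Hg n; rewrite -(rmorph0 (quot_pi boundary_ideal)).
apply/(quot_piE boundary_ideal); rewrite subr0.
have nu : n \in u by rewrite mem_undup mem_cat ns.
have := dg_deg_direct (undup_uniq _) (fun n => dg_degB (Hg' n) (Hh' n)) Eu nu.
move/eqP; rewrite subr_eq0 /g' ns /h' => /eqP En.
case: ifP En => _ En; first by exists (h (n - 1)).
by exists 0; rewrite dg_d0.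
Qed.

Fact hom_dD (x y : hom_alg) : (0 : hom_alg) = 0 + 0.
Proof. by rewrite addr0. Qed.
Fact hom_leibniz (n : int) (x y : hom_alg) :
  hom_deg n x -> 0 = 0 * y + (-1) ^+ absz n * (x * 0).
Proof. by rewrite mul0r !mulr0 addr0. Qed.

Definition homology : dgAlg k I :=
  @DgAlg k I hom_alg hom_deg (fun=> 0) hom_deg0 hom_degB hom_deg_base hom_degM
    hom_deg_sum hom_deg_direct hom_dD (fun=> erefl)
    (fun n x _ => hom_deg0 (n + 1)) hom_leibniz (fun=> erefl).

End Homology.

Section DegreeZero.
Variables (k : fieldType) (I : finType) (A : dgAlg k I).

Lemma degree0_subalg : subalgebra (dg_deg A 0).
Proof.
split=> [s|x y|x y]; [exact: dg_deg_base|exact: dg_degB|].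
by move=> Hx Hy; rewrite -(addr0 0); apply: dg_degM.
Qed.

Definition degree0 : vAlgType k I := subalg_of degree0_subalg.

End DegreeZero.

Section Formality.
Variables (k : fieldType) (I : finType).

Section HomologyMap.
Variables (A B : dgAlg k I) (f : dgHom A B).

Fact cycle_map_proof (z : cycles A) : cycle (f (val z)).
Proof.
by rewrite /cycle -dgHom_d; have -> : dg_d A (val z) = 0 := subalg_inP z;
  rewrite rmorph0.
Qed.
Definition cycle_map (z : cycles A) : cycles B :=
  subalg_in (cycle_subalg B) (cycle_map_proof z).

Definition homology_map (x : homology A) : homology B :=
  hom_class (cycle_map (repr (x : quot (boundary_ideal A)))).

Lemma homology_mapE z : homology_map (hom_class z) = hom_class (cycle_map z).
Proof.
apply/(quot_piE (boundary_ideal B)); have [y Ey] := quot_repr_pi (boundary_ideal A) z.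
exists (f y); rewrite -dgHom_d -Ey rmorphB /=.
by rewrite rmorphB.
Qed.

Definition quasi_iso : Prop := bijective homology_map.
End HomologyMap.

Definition quasi_isomorphic : dgAlg k I -> dgAlg k I -> Prop :=
  clos_refl_sym_trans (dgAlg k I) (fun A B => exists f : dgHom A B, quasi_iso f).

Definition formal (A : dgAlg k I) : Prop := quasi_isomorphic A (homology A).

End Formality.

Definition alg_isomorphic (k : fieldType) (I : finType) (A B : vAlgType k I) :
  Prop := exists f : algHom A B, bijective f.

Section MatrixAlgebra.
Variables (k : fieldType) (I : finType) (A : vAlgType k I) (n : nat).

Definition mx_base (s : {ffun I -> k}) : 'M[A]_n := (base s)%:M.

Fact mx_base_zmod : zmod_morphism mx_base.
Proof. by move=> x y; rewrite /mx_base !rmorphB. Qed.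
Fact mx_base_monoid : monoid_morphism mx_base.
Proof. by split=> [|x y]; rewrite /mx_base ?rmorph1 ?rmorphM. Qed.
Fact mx_base_central (c : k) (M : 'M[A]_n) :
  mx_base [ffun => c] * M = M * mx_base [ffun => c].
Proof.
apply/matrixP => i j; rewrite !mxE (bigD1 i) // [RHS](bigD1 j) //=.
rewrite !big1 ?addr0 => [|m /negPf mj|m /negPf mi].
- by rewrite !mxE !eqxx !mulr1n base_central.
- by rewrite !mxE mj mulr0n mulr0.
- by rewrite !mxE eq_sym mi mulr0n mul0r.
Qed.

HB.instance Definition _ := PzRing_isVertexAlgebra.Build k I 'M[A]_n
  mx_base_zmod mx_base_monoid mx_base_central.

End MatrixAlgebra.

(* For an algebra L and r in L commuting with kI, the dg algebra L *_{kI} kI[s]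
   with L in degree 0, |s| = -1, d|_L = 0 and d(s) = r. *)
Section AdjoinDifferential.
Variables (k : fieldType) (I : finType) (L : vAlgType k I) (r : L).
Hypothesis Hr : forall s, base s * r = r * base s.

Definition koszul_alg : vAlgType k I := freeprod L (kIpoly k I).

Definition kin : algHom L koszul_alg := fpl L (kIpoly k I).
Definition ks : koszul_alg := fpr L (kIpoly k I) (kIvar k I).

(* The least family of additive subgroups, closed under products, such that L
   lies in degree 0 and s in degree -1. *)
Inductive koszul_deg : int -> koszul_alg -> Prop :=
| KDeg_in a : koszul_deg 0 (kin a)
| KDeg_s : koszul_deg (-1) ks
| KDeg0 n : koszul_deg n 0
| KDegB n x y : koszul_deg n x -> koszul_deg n y -> koszul_deg n (x - y)
| KDegM m n x y : koszul_deg m x -> koszul_deg n y -> koszul_deg (m + n) (x * y).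

Lemma ks_comm s : base s * ks = ks * base s.
Proof.
rewrite -[base s in LHS](algHom_base (fpr L (kIpoly k I))).
rewrite -[base s in RHS](algHom_base (fpr L (kIpoly k I))).
by rewrite /ks -!rmorphM kIvar_comm.
Qed.

Lemma koszul_ind (P : koszul_alg -> Prop) :
  (forall a, P (kin a)) -> P ks ->
  (forall x y, P x -> P y -> P (x + y)) -> (forall x, P x -> P (- x)) ->
  (forall x y, P x -> P y -> P (x * y)) -> forall x, P x.
Proof.
move=> Pa Ps PD PN PM; apply: freeprod_ind => //.
apply: adjoin_ind => [s|[]|x y|x|x y].
- rewrite -[adj_cst _ _]/(base s : kIpoly k I) algHom_base.
  by rewrite -(algHom_base kin); apply: Pa.
- exact: Ps.
- by rewrite rmorphD; apply: PD.
- by rewrite rmorphN; apply: PN.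
- by rewrite rmorphM; apply: PM.
Qed.

Section KoszulLift.
Variables (C : vAlgType k I) (f : algHom L C) (c : C).
Hypothesis Hc : forall s, base s * c = c * base s.
Definition koszul_lift : algHom koszul_alg C := fp_lift f (poly_lift Hc).
Lemma koszul_lift_in a : koszul_lift (kin a) = f a.
Proof. exact: fp_lift_l. Qed.
Lemma koszul_lift_s : koszul_lift ks = c.
Proof. by rewrite /koszul_lift /ks fp_lift_r poly_lift_var. Qed.
End KoszulLift.

Definition diagn_fun m (a : L) : 'M[koszul_alg]_m.+1 := (kin a)%:M.
Fact diagn_zmod m : zmod_morphism (diagn_fun m).
Proof. by move=> x y; rewrite /diagn_fun !rmorphB. Qed.
Fact diagn_monoid m : monoid_morphism (diagn_fun m).
Proof. by split=> [|x y]; rewrite /diagn_fun ?rmorph1 ?rmorphM. Qed.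
HB.instance Definition _ m := GRing.isZmodMorphism.Build L 'M[koszul_alg]_m.+1
  (diagn_fun m) (diagn_zmod m).
HB.instance Definition _ m := GRing.isMonoidMorphism.Build L 'M[koszul_alg]_m.+1
  (diagn_fun m) (diagn_monoid m).
Fact diagn_base m s : diagn_fun m (base s) = base s.
Proof. by rewrite /diagn_fun algHom_base. Qed.
Definition diagn m : algHom L ('M[koszul_alg]_m.+1 : vAlgType k I) :=
  @AlgHom k I L 'M[koszul_alg]_m.+1 (diagn_fun m) (@diagn_base m).

(* The derivation d is read off from the algebra map
   x |-> [[(-1)^|x| x, d x], [0, x]] to 2 x 2 matrices, which sends s to
   [[-s, r], [0, s]]. *)
Definition kmx (a b c : koszul_alg) : 'M[koszul_alg]_2 :=
  \matrix_(i, j) if i == 0 then if j == 0 then a else b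
                 else if j == 0 then 0 else c.

Lemma kmxM a b c a' b' c' :
  kmx a b c * kmx a' b' c' = kmx (a * a') (a * b' + b * c') (c * c').
Proof.
apply/matrixP => i j; rewrite !mxE big_ord_recl big_ord1 !mxE.
by case: i => [[|[|//]] ?]; case: j => [[|[|//]] ?] /=;
  rewrite ?(mul0r, mulr0, addr0, add0r).
Qed.
Lemma kmxD a b c a' b' c' :
  kmx a b c + kmx a' b' c' = kmx (a + a') (b + b') (c + c').
Proof. by apply/matrixP => i j; rewrite !mxE; do 2?case: ifP; rewrite ?addr0. Qed.
Lemma kmxN a b c : - kmx a b c = kmx (- a) (- b) (- c).
Proof. by apply/matrixP => i j; rewrite !mxE; do 2?case: ifP; rewrite ?oppr0. Qed.
Lemma kmx_scalar a : a%:M = kmx a 0 a.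
Proof.
by apply/matrixP => i j; rewrite !mxE;
  case: i => [[|[|//]] ?]; case: j => [[|[|//]] ?].
Qed.

Fact kmx_s_comm s : base s * kmx (- ks) (kin r) ks = kmx (- ks) (kin r) ks * base s.
Proof.
rewrite -[base s]/((base s)%:M) kmx_scalar !kmxM !mul0r !mulr0 !addr0 add0r.
rewrite mulrN mulNr ks_comm; congr (kmx _ _ _).
by rewrite -(algHom_base kin) -!rmorphM Hr.
Qed.

Definition koszul_mx : algHom koszul_alg ('M[koszul_alg]_2 : vAlgType k I) :=
  koszul_lift (diagn 1) kmx_s_comm.

Definition koszul_d (x : koszul_alg) : koszul_alg := koszul_mx x 0 1.
Definition koszul_sg (x : koszul_alg) : koszul_alg := koszul_mx x 0 0.

Lemma koszul_mxE x : koszul_mx x = kmx (koszul_sg x) (koszul_d x) x.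
Proof.
suff [a [b E]] : exists a b, koszul_mx x = kmx a b x.
  by rewrite /koszul_sg /koszul_d E !mxE.
elim/koszul_ind: x => [a||x y [a [b E]] [a' [b' E']]|x [a [b E]]
                      |x y [a [b E]] [a' [b' E']]].
- by exists (kin a), 0; rewrite koszul_lift_in -kmx_scalar.
- by exists (- ks), (kin r); rewrite koszul_lift_s.
- by exists (a + a'), (b + b'); rewrite rmorphD E E' kmxD.
- by exists (- a), (- b); rewrite rmorphN E kmxN.
- by exists (a * a'), (a * b' + b * y); rewrite rmorphM E E' kmxM.
Qed.

Lemma koszul_d_in a : koszul_d (kin a) = 0.
Proof. by rewrite /koszul_d koszul_lift_in [diagn 1 _]kmx_scalar mxE. Qed.
Lemma koszul_d_s : koszul_d ks = kin r.
Proof. by rewrite /koszul_d koszul_lift_s mxE. Qed.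
Lemma koszul_sg_in a : koszul_sg (kin a) = kin a.
Proof. by rewrite /koszul_sg koszul_lift_in [diagn 1 _]kmx_scalar mxE. Qed.
Lemma koszul_sg_s : koszul_sg ks = - ks.
Proof. by rewrite /koszul_sg koszul_lift_s mxE. Qed.
Lemma koszul_dD x y : koszul_d (x + y) = koszul_d x + koszul_d y.
Proof. by rewrite /koszul_d rmorphD mxE. Qed.
Lemma koszul_dB x y : koszul_d (x - y) = koszul_d x - koszul_d y.
Proof. by rewrite /koszul_d rmorphB !mxE. Qed.
Lemma koszul_dN x : koszul_d (- x) = - koszul_d x.
Proof. by rewrite /koszul_d rmorphN mxE. Qed.
Lemma koszul_d0 : koszul_d 0 = 0.
Proof. by rewrite /koszul_d rmorph0 mxE. Qed.
Lemma koszul_sgB x y : koszul_sg (x - y) = koszul_sg x - koszul_sg y.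
Proof. by rewrite /koszul_sg rmorphB !mxE. Qed.
Lemma koszul_sgD x y : koszul_sg (x + y) = koszul_sg x + koszul_sg y.
Proof. by rewrite /koszul_sg rmorphD !mxE. Qed.
Lemma koszul_sgN x : koszul_sg (- x) = - koszul_sg x.
Proof. by rewrite /koszul_sg rmorphN mxE. Qed.
Lemma koszul_sg0 : koszul_sg 0 = 0.
Proof. by rewrite /koszul_sg rmorph0 mxE. Qed.
Lemma koszul_sgM x y : koszul_sg (x * y) = koszul_sg x * koszul_sg y.
Proof. by rewrite {1}/koszul_sg rmorphM !koszul_mxE kmxM mxE. Qed.
Lemma koszul_dM x y :
  koszul_d (x * y) = koszul_d x * y + koszul_sg x * koszul_d y.
Proof. by rewrite {1}/koszul_d rmorphM !koszul_mxE kmxM mxE addrC. Qed.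

Lemma exprN1_absD (R : pzRingType) (m n : int) :
  (-1) ^+ absz (m + n) = (-1) ^+ absz m * (-1) ^+ absz n :> R.
Proof.
rewrite -exprD -[LHS]signr_odd -[RHS]signr_odd; congr (_ ^+ nat_of_bool _).
by rewrite oddD; lia.
Qed.

Lemma koszul_sg_deg n x : koszul_deg n x -> koszul_sg x = (-1) ^+ absz n * x.
Proof.
elim=> {n x} [a||n|n x y _ IHx _ IHy|m n x y _ IHx _ IHy].
- by rewrite koszul_sg_in expr0 mul1r.
- by rewrite koszul_sg_s expr1 mulN1r.
- by rewrite koszul_sg0 mulr0.
- by rewrite koszul_sgB IHx IHy mulrBr.
- rewrite koszul_sgM IHx IHy exprN1_absD -!mulrA; congr (_ * _).
  by rewrite [LHS]mulrA (commr_sign x) -mulrA.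
Qed.

Fact koszul_leibniz n x y : koszul_deg n x ->
  koszul_d (x * y) = koszul_d x * y + (-1) ^+ absz n * (x * koszul_d y).
Proof. by move=> Hx; rewrite koszul_dM (koszul_sg_deg Hx) mulrA. Qed.

Lemma koszul_degN n x : koszul_deg n x -> koszul_deg n (- x).
Proof. by move=> Hx; rewrite -sub0r; apply: KDegB Hx; apply: KDeg0. Qed.
Lemma koszul_degD n x y :
  koszul_deg n x -> koszul_deg n y -> koszul_deg n (x + y).
Proof.
by move=> Hx /koszul_degN Hy; rewrite -(opprK y); apply: KDegB Hx Hy.
Qed.

Fact koszul_d_deg n x : koszul_deg n x -> koszul_deg (n + 1) (koszul_d x).
Proof.
elim=> {n x} [a||n|n x y _ IHx _ IHy|m n x y Hx IHx Hy IHy].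
- by rewrite koszul_d_in; apply: KDeg0.
- by rewrite koszul_d_s; apply: KDeg_in.
- by rewrite koszul_d0; apply: KDeg0.
- by rewrite koszul_dB; apply: KDegB.
- rewrite (koszul_leibniz _ Hx); apply: koszul_degD.
    by rewrite addrAC; apply: KDegM.
  have H : koszul_deg (m + n + 1) (x * koszul_d y).
    by rewrite -addrA; apply: KDegM.
  rewrite -signr_odd; case: (odd _); rewrite ?expr0 ?expr1 ?mul1r ?mulN1r //.
  exact: koszul_degN.
Qed.

Lemma koszul_sg_d x : koszul_sg (koszul_d x) = - koszul_d (koszul_sg x).
Proof.
elim/koszul_ind: x => [a||x y Hx Hy|x Hx|x y Hx Hy].
- by rewrite koszul_sg_in koszul_d_in koszul_sg0 oppr0.
- by rewrite koszul_d_s koszul_sg_in koszul_sg_s koszul_dN koszul_d_s opprK.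
- by rewrite koszul_dD !koszul_sgD koszul_dD Hx Hy opprD.
- by rewrite koszul_dN !koszul_sgN koszul_dN Hx.
- rewrite koszul_dM koszul_sgD !koszul_sgM koszul_dM Hx Hy.
  by rewrite mulNr mulrN opprD.
Qed.

Fact koszul_dd x : koszul_d (koszul_d x) = 0.
Proof.
elim/koszul_ind: x => [a||x y Hx Hy|x Hx|x y Hx Hy].
- by rewrite koszul_d_in koszul_d0.
- by rewrite koszul_d_s koszul_d_in.
- by rewrite !koszul_dD Hx Hy addr0.
- by rewrite !koszul_dN Hx oppr0.
- rewrite koszul_dM koszul_dD !koszul_dM Hx Hy mul0r mulr0 addr0 add0r.
  by rewrite koszul_sg_d mulNr addNr.
Qed.

Fact koszul_deg_base s : koszul_deg 0 (base s).
Proof. by rewrite -(algHom_base kin); apply: KDeg_in. Qed.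

Fact koszul_d_base s : koszul_d (base s) = 0.
Proof. by rewrite -(algHom_base kin) koszul_d_in. Qed.

Lemma koszul_deg_bigsum n (J : eqType) (s : seq J) (F : J -> koszul_alg) :
  (forall j, j \in s -> koszul_deg n (F j)) ->
  koszul_deg n (\sum_(j <- s) F j).
Proof.
move=> H; rewrite big_seq; elim/big_ind: _ => //; first exact: KDeg0.
exact: koszul_degD.
Qed.

Fact koszul_deg_sum x : exists (s : seq int) (f : int -> koszul_alg),
  [/\ uniq s, forall n, koszul_deg n (f n) & x = \sum_(n <- s) f n].
Proof.
suff [t [Ht ->]] : exists t : seq (int * koszul_alg),
    (forall p, p \in t -> koszul_deg p.1 p.2) /\ x = \sum_(p <- t) p.2.
  exists (undup [seq p.1 | p <- t]), (fun n => \sum_(p <- t | p.1 == n) p.2).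
  split; first exact: undup_uniq.
    move=> n; rewrite -big_filter; apply: koszul_deg_bigsum => p.
    by rewrite mem_filter => /andP[/eqP <-]; apply: Ht.
  rewrite (exchange_big_dep xpredT) //=; apply: eq_big_seq => p pt.
  rewrite big_mkcond (bigD1_seq p.1) ?undup_uniq ?mem_undup ?map_f //= eqxx.
  by rewrite big1 ?addr0 // => n /negPf np; rewrite eq_sym np.
elim/koszul_ind: x => [a||x y [t [Ht ->]] [u [Hu ->]]|x [t [Ht ->]]
                      |x y [t [Ht ->]] [u [Hu ->]]].
- by exists [:: (0, kin a)]; rewrite big_seq1; split=> // p /[!inE]/eqP->;
    apply: KDeg_in.
- by exists [:: (- 1, ks)]; rewrite big_seq1; split=> // p /[!inE]/eqP->;
    apply: KDeg_s.
- exists (t ++ u); rewrite big_cat; split=> // p.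
  by rewrite mem_cat => /orP[/Ht|/Hu].
- exists [seq (p.1, - p.2) | p <- t]; rewrite big_map sumrN; split=> // p.
  by case/mapP=> p' /Ht Hp' -> /=; apply: koszul_degN.
- exists [seq (p.1 + p'.1, p.2 * p'.2) | p <- t, p' <- u]; split.
    by move=> p /allpairsP[[p1 p2] [/Ht H1 /Hu H2 ->]]; apply: KDegM.
  rewrite big_allpairs_dep mulr_suml; apply: eq_bigr => p _.
  by rewrite mulr_sumr.
Qed.

(* Directness of the grading, via the algebra maps l |-> l 1, s |-> s N, with N
   the nilpotent shift matrix of size m + 1. *)
Definition shift_mx m : 'M[koszul_alg]_m.+1 :=
  \matrix_(i, j) (if j == i.+1 :> nat then ks else 0).

Fact shift_comm m s : base s * shift_mx m = shift_mx m * base s.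
Proof.
apply/matrixP => i j; rewrite -[base s]/((base s)%:M).
rewrite -mulmxE mul_scalar_mx mxE mxE mxE (bigD1 j) //= big1 => [|l /negPf lj].
  by rewrite !mxE eqxx mulr1n addr0; case: ifP => _; rewrite ?mulr0 ?mul0r ?ks_comm.
by rewrite !mxE lj mulr0n mulr0.
Qed.

Definition shift_hom m : algHom koszul_alg ('M[koszul_alg]_m.+1 : vAlgType k I) :=
  koszul_lift (diagn m) (@shift_comm m).

Lemma koszul_deg_pos n x : koszul_deg n x -> 0 < n -> x = 0.
Proof.
elim=> {n x} [//|//|//|q z w _ IHz _ IHw q0|q q' z w _ IHz _ IHw q0].
  by rewrite IHz ?IHw ?subr0.
have [q1|q1] := ltP 0 q; first by rewrite IHz ?mul0r.
by rewrite IHw ?mulr0 //; lia.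
Qed.

Lemma shift_deg m n x : koszul_deg n x -> forall i j : 'I_m.+1,
  shift_hom m x i j = if (j%:Z == i%:Z - n) then x else 0.
Proof.
elim=> {n x} [a||n|n x y _ IHx _ IHy|p n x y Hx IHx Hy IHy] i j.
- rewrite koszul_lift_in mxE subr0 eq_sym.
  by rewrite -val_eqE /=; case: eqP => [->|ne]; rewrite ?eqxx //; case: eqP => // -[].
- by rewrite koszul_lift_s mxE opprK -PoszD addn1 eqz_nat.
- by rewrite rmorph0 mxE if_same.
- by rewrite rmorphB !mxE IHx IHy; case: ifP; rewrite ?subr0.
- rewrite rmorphM mxE.
  have [p0|p0] := ltP 0 p.
    rewrite (koszul_deg_pos Hx) // mul0r if_same big1 // => l _.
    by rewrite rmorph0 mxE mul0r.
  have [n0|n0] := ltP 0 n.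
    rewrite (koszul_deg_pos Hy) // mulr0 if_same big1 // => l _.
    by rewrite rmorph0 mxE mulr0.
  case: eqP => [E|E].
    have lt : (i + absz p < m.+1)%N by have := ltn_ord j; lia.
    rewrite (bigD1 (Ordinal lt)) //= big1 => [|l].
      by rewrite IHx IHy /= !ifT ?addr0 //; lia.
    rewrite IHx -val_eqE /= => ne; rewrite ifF ?mul0r //; lia.
  rewrite big1 // => l _; rewrite IHx IHy.
  case: eqP => [E1|_]; last by rewrite mul0r.
  case: eqP => [E2|_]; last by rewrite mulr0.
  by case: E; lia.
Qed.

Fact koszul_deg_direct (s : seq int) (f : int -> koszul_alg) : uniq s ->
  (forall n, koszul_deg n (f n)) -> \sum_(n <- s) f n = 0 ->
  forall n, n \in s -> f n = 0.
Proof.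
move=> us Hf E n ns; have [n0|n0] := ltP 0 n; first exact: koszul_deg_pos (Hf n) n0.
have := congr1 (fun x => shift_hom (absz n) x 0 ord_max) E.
rewrite rmorph0 raddf_sum summxE mxE (bigD1_seq n) //= (shift_deg (Hf n)) ifT; last first.
  by rewrite /=; lia.
rewrite big1_seq ?addr0 // => j /andP[jn _]; rewrite (shift_deg (Hf j)) ifF //=.
by lia.
Qed.

Definition koszul_dg : dgAlg k I :=
  @DgAlg k I koszul_alg koszul_deg koszul_d KDeg0 KDegB koszul_deg_base KDegM
    koszul_deg_sum koszul_deg_direct koszul_dD koszul_d_base koszul_d_deg
    koszul_leibniz koszul_dd.

End AdjoinDifferential.

Definition dg_preproj (k : fieldType) (Q : quiver) (le : rel (arrow (doubleQ Q)))
    (q : {ffun vertex Q -> k}) : dgAlg k (vertex Q) :=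
  koszul_dg (base_rel_elt le q).

(* Main.v *)
Require Import Defs.
From HB Require Import structures.
From mathcomp Require Import all_boot all_order all_algebra.
From mathcomp Require Import boolp functions.
From Stdlib Require Import Relations.Relation_Operators.

Set Implicit Arguments.
Unset Strict Implicit.
Unset Printing Implicit Defensive.

Import GRing.Theory.
Local Open Scope ring_scope.

(* Write L for L_Q, P for Lambda^q(Q) and K = L * kQ_0[s] for the dg algebra.
   In P * B, replacing the first t of a word a_0 t x by the marker s gives, through
   the inverse of sigma', an additive map h : L -> L s L with h (sigma a) = 0 and
   h (sigma a r l) = sigma a s l. Extending h to K by acting on the part of a word
   preceding its first s gives a homotopy H with
     d H + H d = id - sigma p,
   where p : K -> P is the algebra map equal to the projection on L and killing s.
   Hence p induces an isomorphism from the homology of K to P, and K is formal via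
   the map K -> H(K) sending l in L to its class and s to 0. *)

(** * Right modules and their endomorphism algebras *)

Record rmod (k : fieldType) (I : finType) (A : vAlgType k I) (N : zmodType) :=
  RMod {
    ract : A -> N -> N;
    ractBl : forall a, {morph ract a : x y / x - y};
    ractBr : forall x, {morph ract^~ x : a b / a - b};
    ract1 : forall x, ract 1 x = x;
    ractM : forall x a b, ract (a * b) x = ract b (ract a x)
  }.

Section RModTheory.
Variables (k : fieldType) (I : finType) (A : vAlgType k I) (N : zmodType).
Variable M : rmod A N.

HB.instance Definition _ a := GRing.isZmodMorphism.Build N N
  (ract M a) (ractBl M a).

Lemma ractDl x y a : ract M a (x + y) = ract M a x + ract M a y.
Proof. exact: (raddfD (ract M a)). Qed.
Lemma ractDr a b x : ract M (a + b) x = ract M a x + ract M b x.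
Proof. by rewrite -[in RHS](addrK b a) ractBr subrK. Qed.
Lemma ractNr a x : ract M (- a) x = - ract M a x.
Proof.
by apply: (addIr (ract M a x)); rewrite -ractDr !addNr -(subrr 0) ractBr subrr.
Qed.
Lemma ract0l a : ract M a 0 = 0.
Proof. exact: (raddf0 (ract M a)). Qed.
Lemma ractNl x a : ract M a (- x) = - ract M a x.
Proof. exact: (raddfN (ract M a)). Qed.

Definition regular_rmod : rmod A A :=
  @RMod _ _ A A (fun a x => x * a) (fun a x y => mulrBl a x y)
    (fun x a b => mulrBr x a b) (@mulr1 A) (@mulrA A).

Definition restrict_rmod (B : vAlgType k I) (f : algHom B A) : rmod B N.
Proof.
exists (fun b x => ract M (f b) x).
- by move=> b x y; rewrite ractBl.
- by move=> x b c; rewrite rmorphB ractBr.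
- by move=> x; rewrite rmorph1 ract1.
- by move=> x b c; rewrite rmorphM ractM.
Defined.

Definition pair_rmod (N' : zmodType) (M' : rmod A N') : rmod A (N * N')%type.
Proof.
exists (fun a x => (ract M a x.1, ract M' a x.2)).
- by move=> a x y; rewrite /= !ractBl.
- by move=> x a b; rewrite /= !ractBr.
- by move=> [x y]; rewrite /= !ract1.
- by move=> x a b; rewrite /= !ractM.
Defined.

End RModTheory.

Section Endomorphisms.
Variables (k : fieldType) (I : finType) (N : zmodType) (M : rmod (kI k I) N).

(** Only the constants must commute with an endomorphism, as [base_central] demands; linearity over
    all of [kI k I] would exclude right multiplication by elements that do not commute with the
    vertex idempotents. *)
Record endo := Endo {
  endo_fun :> N -> N;
  endoB : {morph endo_fun : x y / x - y};
  endo_lin : forall (c : k) x,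
    endo_fun (ract M [ffun => c] x) = ract M [ffun => c] (endo_fun x)
}.

HB.instance Definition _ := gen_eqMixin endo.
HB.instance Definition _ := gen_choiceMixin endo.

Lemma endo_ext (f g : endo) : f =1 g -> f = g.
Proof.
case: f g => [f fB fl] [g gB gl] /funext /= E; case: _ / E gB gl => gB gl.
by rewrite (Prop_irrelevance fB gB) (Prop_irrelevance fl gl).
Qed.

HB.instance Definition _ (f : endo) := GRing.isZmodMorphism.Build N N f (@endoB f).

Definition endo_zero : endo.
Proof. by exists (fun=> 0) => [x y|c x]; rewrite ?subr0 ?ract0l. Defined.
Definition endo_add (f g : endo) : endo.
Proof.
exists (fun x => f x + g x) => [x y|c x]; first by rewrite !endoB addrACA opprD.
by rewrite !endo_lin ractDl.
Defined.
Definition endo_opp (f : endo) : endo.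
Proof.
exists (fun x => - f x) => [x y|c x]; first by rewrite endoB opprB opprK addrC.
by rewrite endo_lin ractNl.
Defined.
Definition endo_one : endo. Proof. by exists id. Defined.
(* Composition is reversed: endomorphisms act on the right. *)
Definition endo_mul (f g : endo) : endo.
Proof. by exists (g \o f) => [x y|c x] /=; rewrite ?endoB ?endo_lin. Defined.

Fact endo_addA : associative endo_add.
Proof. by move=> f g h; apply: endo_ext => x; apply: addrA. Qed.
Fact endo_addC : commutative endo_add.
Proof. by move=> f g; apply: endo_ext => x; apply: addrC. Qed.
Fact endo_add0 : left_id endo_zero endo_add.
Proof. by move=> f; apply: endo_ext => x; apply: add0r. Qed.
Fact endo_addN : left_inverse endo_zero endo_opp endo_add.
Proof. by move=> f; apply: endo_ext => x; apply: addNr. Qed.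
Fact endo_mulA : associative endo_mul.
Proof. by move=> f g h; apply: endo_ext. Qed.
Fact endo_mul1 : left_id endo_one endo_mul.
Proof. by move=> f; apply: endo_ext. Qed.
Fact endo_1mul : right_id endo_one endo_mul.
Proof. by move=> f; apply: endo_ext. Qed.
Fact endo_mulDl : left_distributive endo_mul endo_add.
Proof. by move=> f g h; apply: endo_ext => x /=; rewrite raddfD. Qed.
Fact endo_mulDr : right_distributive endo_mul endo_add.
Proof. by move=> f g h; apply: endo_ext. Qed.

HB.instance Definition _ := GRing.isPzRing.Build endo
  endo_addA endo_addC endo_add0 endo_addN endo_mulA endo_mul1 endo_1mul
  endo_mulDl endo_mulDr.

Definition endo_base (s : {ffun I -> k}) : endo.
Proof.
exists (fun x => ract M (s : kI k I) x) => [x y|c x]; first by rewrite ractBl.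
by rewrite -!ractM kI_mulC.
Defined.

Fact endo_base_zmod : zmod_morphism endo_base.
Proof. by move=> s t; apply: endo_ext => x; apply: (ractBr M). Qed.
Fact endo_base_monoid : monoid_morphism endo_base.
Proof.
split=> [|s t]; apply: endo_ext => x; first exact: (ract1 M).
exact: (ractM M x).
Qed.
Fact endo_base_central (c : k) (f : endo) :
  endo_base [ffun => c] * f = f * endo_base [ffun => c].
Proof. by apply: endo_ext => x; apply: endo_lin. Qed.

HB.instance Definition _ := PzRing_isVertexAlgebra.Build k I endo
  endo_base_zmod endo_base_monoid endo_base_central.

Lemma endoDE (f g : endo) x : (f + g) x = f x + g x. Proof. by []. Qed.
Lemma endoNE (f : endo) x : (- f) x = - f x. Proof. by []. Qed.
Lemma endoME (f g : endo) x : (f * g) x = g (f x). Proof. by []. Qed.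
Lemma endo_baseE s x : (base s : endo) x = ract M s x. Proof. by []. Qed.

End Endomorphisms.

(* A right action of an algebra generated by A and t on A x N in which t sends
   (a, g) to (0, delta a + g t): reading a word from (1, 0) applies delta at the
   first occurrence of t. *)
Section FirstOccurrence.
Variables (k : fieldType) (I : finType) (A X : vAlgType k I) (i : algHom A X).
Variables (N : zmodType) (M : rmod X N) (t : X).
Hypothesis Ht : forall s, base s * t = t * base s.
Variable delta : A -> N.
Hypothesis deltaB : {morph delta : x y / x - y}.
Hypothesis delta_base : forall a s,
  delta (a * base s) = ract M (base s) (delta a).

Definition fo_rmod : rmod (kI k I) (A * N)%type :=
  pair_rmod (restrict_rmod (regular_rmod A) (base_hom A))
            (restrict_rmod M (base_hom X)).

Lemma fo_ractE x s : ract fo_rmod s x = (x.1 * base s, ract M (base s) x.2).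
Proof. by []. Qed.

Definition fo_alg_fun (a : A) : endo fo_rmod.
Proof.
exists (fun x => (x.1 * a, ract M (i a) x.2)) => [x y|c x].
  by rewrite /= mulrBl ractBl.
rewrite !fo_ractE /= -!mulrA -!ractM base_central.
by rewrite -(algHom_base i) -!rmorphM base_central.
Defined.

Fact fo_alg_zmod : zmod_morphism fo_alg_fun.
Proof.
by move=> a b; apply: endo_ext => x /=; rewrite mulrBr rmorphB ractBr.
Qed.
Fact fo_alg_monoid : monoid_morphism fo_alg_fun.
Proof.
split=> [|a b]; apply: endo_ext => x /=.
  by rewrite mulr1 rmorph1 ract1 -surjective_pairing.
by rewrite mulrA rmorphM ractM.
Qed.
HB.instance Definition _ := GRing.isZmodMorphism.Build A (endo fo_rmod)
  fo_alg_fun fo_alg_zmod.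
HB.instance Definition _ := GRing.isMonoidMorphism.Build A (endo fo_rmod)
  fo_alg_fun fo_alg_monoid.

Fact fo_alg_base s : fo_alg_fun (base s) = base s.
Proof. by apply: endo_ext => x; rewrite /= algHom_base. Qed.

Definition fo_alg : algHom A (endo fo_rmod : vAlgType k I) :=
  @AlgHom k I A (endo fo_rmod) fo_alg_fun fo_alg_base.

Definition fo_t : endo fo_rmod.
Proof.
exists (fun x => (0, delta x.1 + ract M t x.2)) => [x y|c x].
  by congr (_, _); rewrite ?subr0 //= deltaB ractBl addrACA opprD.
rewrite !fo_ractE /= mul0r delta_base ractDl -!ractM.
by rewrite Ht.
Defined.

Lemma fo_t_comm s : base s * fo_t = fo_t * base s.
Proof.
apply: endo_ext => x; rewrite !endoME !endo_baseE !fo_ractE /=.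
by rewrite mul0r delta_base ractDl -!ractM Ht.
Qed.

Lemma fo_algE a x : fo_alg a x = (x.1 * a, ract M (i a) x.2). Proof. by []. Qed.
Lemma fo_tE x : fo_t x = (0, delta x.1 + ract M t x.2). Proof. by []. Qed.

Section Inverse.
Variables (c c' : {ffun I -> k}) (u : X).
Hypothesis cV : c * c' = 1.
Hypotheses (tuV : (base c + t) * u = 1) (utV : u * (base c + t) = 1).

(** The solution of (a, g) (c + t) = (a c, delta a + g (c + t)): the first component is divided by
    c, then [delta] of the result is subtracted before dividing by c + t. *)
Definition fo_inv : endo fo_rmod.
Proof.
exists (fun x => (x.1 * base c', ract M u (x.2 - delta (x.1 * base c'))))
  => [x y|b x].
  congr (_, _); rewrite /= mulrBl // deltaB -ractBl; congr ract.
  by rewrite !opprD addrACA.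
rewrite !fo_ractE /= -!mulrA !base_central; congr (_, _).
by rewrite mulrA delta_base -ractBl -!ractM base_central.
Defined.

Lemma fo_invE x : fo_inv x = (x.1 * base c', ract M u (x.2 - delta (x.1 * base c'))).
Proof. by []. Qed.

Lemma fo_mulrV : (base c + fo_t) * fo_inv = 1.
Proof.
apply: endo_ext => -[a g].
rewrite endoME endoDE endo_baseE fo_ractE fo_tE fo_invE /=.
rewrite addr0 -mulrA -rmorphM cV rmorph1 mulr1 (addrC (delta a)) addrA addrK.
by rewrite -ractDr -ractM tuV ract1.
Qed.

Lemma fo_mulVr : fo_inv * (base c + fo_t) = 1.
Proof.
apply: endo_ext => -[a g].
rewrite endoME endoDE endo_baseE fo_ractE fo_tE fo_invE /=.
congr (_, _); rewrite /= -?mulrA.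
  by rewrite addr0 -rmorphM (kI_mulC (c' : kI k I)) cV rmorph1 mulr1.
by rewrite addrCA -ractDr -ractM utV ract1 addrC subrK.
Qed.

End Inverse.

End FirstOccurrence.

(** * Additive maps and coinduced modules *)

Section AdditiveMaps.
Variables (U V : zmodType).

Definition addmap_pred : pred (U -> V) := fun f => `[< zmod_morphism f >].

Fact addmap_closed : zmod_closed addmap_pred.
Proof.
split=> [|f g]; rewrite !unfold_in.
  by apply/asboolP => x y; rewrite [RHS]subr0.
move=> /asboolP fB /asboolP gB; apply/asboolP => x y.
rewrite -[(f - g) (x - y)]/(f (x - y) - g (x - y)) fB gB.
by rewrite -[(f - g) x]/(f x - g x) -[(f - g) y]/(f y - g y) !opprD addrACA.
Qed.

Record addmap := AddMap { addmap_fun :> U -> V; addmapP : addmap_pred addmap_fun }.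

HB.instance Definition _ := [isSub for addmap_fun].
HB.instance Definition _ := [Choice of addmap by <:].
HB.instance Definition _ :=
  GRing.SubChoice_isSubZmodule.Build (U -> V) addmap_pred addmap addmap_closed.

Fact addmap_zmod (f : addmap) : zmod_morphism f.
Proof. exact/asboolP/addmapP. Qed.
HB.instance Definition _ (f : addmap) := GRing.isZmodMorphism.Build U V f
  (addmap_zmod f).

Definition mk_addmap (f : U -> V) (fB : zmod_morphism f) : addmap :=
  @AddMap f (introT (asboolP _) fB).

Lemma addmap_ext (f g : addmap) : f =1 g -> f = g.
Proof. by move=> /funext E; apply: val_inj. Qed.

Lemma addmapBE (f g : addmap) x : (f - g) x = f x - g x.
Proof. by rewrite -[LHS]/(val (f - g) x) raddfB. Qed.

End AdditiveMaps.

Section CoinducedModule.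
Variables (k : fieldType) (I : finType) (X : vAlgType k I) (V : zmodType).

Definition coind_act (x : X) (g : addmap X V) : addmap X V.
Proof.
by apply: (@mk_addmap _ _ (fun y => g (x * y))) => y z; rewrite mulrBr raddfB.
Defined.

Lemma coind_actE x g y : coind_act x g y = g (x * y). Proof. by []. Qed.

(** Precomposing with left multiplications is a right action. Evaluated at 1, the action of x on g
    gives g(x), so a map can be recovered from the action. *)
Definition coind_rmod : rmod X (addmap X V).
Proof.
exists coind_act.
- by move=> x f g; apply: addmap_ext => y; rewrite !(coind_actE, addmapBE).
- move=> g x y; apply: addmap_ext => z.
  by rewrite addmapBE !coind_actE mulrBl raddfB.
- by move=> g; apply: addmap_ext => y; rewrite coind_actE mul1r.
- by move=> g x y; apply: addmap_ext => z; rewrite !coind_actE mulrA.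
Defined.

End CoinducedModule.

(** * Extension of a map on L to K through the part of a word before its first s *)

Section KoszulFirstOccurrence.
Variables (k : fieldType) (I : finType) (L : vAlgType k I).
Local Notation K := (koszul_alg L).
Local Notation kin := (kin L).
Local Notation ks := (ks L).
Variable h : L -> K.
Hypothesis hB : zmod_morphism h.
Hypothesis h_base : forall a s, h (a * base s) = h a * base s.

HB.instance Definition _ := GRing.isZmodMorphism.Build L K h hB.

(** A word l s x read from (1, 0) passes through (l, 0) and (0, h(l) s) to (0, h(l) s x). *)
Let delta (a : L) : K := h a * ks.

Let deltaB : {morph delta : x y / x - y}.
Proof. by move=> x y; rewrite /delta raddfB mulrBl. Qed.

Let delta_base a s : delta (a * base s) = ract (regular_rmod K) (base s) (delta a).
Proof. by rewrite /delta /= h_base -!mulrA ks_comm. Qed.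

Let phi := koszul_lift (fo_alg kin (regular_rmod K))
  (fo_t_comm (M := regular_rmod K) (@ks_comm k I L) deltaB delta_base).

(** Once an s has been read the first component is 0, where [delta] vanishes, so the rest of the
    word is only multiplied on. *)
Lemma koszul_fo_right y x : phi x (0, y) = (0, y * x).
Proof.
elim/koszul_ind: x y => [a||x x' IH IH'|x IH|x x' IH IH'] y.
- by rewrite /phi koszul_lift_in fo_algE /= mul0r.
- rewrite /phi koszul_lift_s fo_tE /=.
  by congr (_, _); rewrite /delta raddf0 mul0r add0r.
- by rewrite rmorphD endoDE IH IH' mulrDr; congr (_, _); rewrite /= addr0.
- by rewrite rmorphN endoNE IH mulrN; congr (_, _); rewrite /= oppr0.
- by rewrite rmorphM endoME IH IH' mulrA.
Qed.

Lemma koszul_extend : exists H : K -> K, [/\ zmod_morphism H,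
  forall a, H (kin a) = h a & forall a x, H (kin a * ks * x) = h a * ks * x].
Proof.
(* A word without s ends at (a, 0) and [h] has yet to be applied; a word with an s ends with first
   component 0. The sum covers both cases. *)
exists (fun x => let n := phi x (1, 0) in n.2 + h n.1); split.
- by move=> x y /=; rewrite !rmorphB /= raddfB opprD addrACA.
- by move=> a /=; rewrite /phi koszul_lift_in fo_algE /= mul0r mul1r add0r.
- move=> a x; rewrite /= !rmorphM !endoME /=.
  rewrite [in phi (kin a)]/phi koszul_lift_in fo_algE /= mul0r mul1r.
  rewrite [in phi ks]/phi koszul_lift_s fo_tE /= mul0r addr0 koszul_fo_right /=.
  by rewrite raddf0 addr0.
Qed.

End KoszulFirstOccurrence.

(** * The algebra B = kQ_0[t, (q + t)^{-1}] *)

Section LocalizedPolynomials.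
Variables (k : fieldType) (Q : quiver) (q : {ffun vertex Q -> k}).
Hypothesis q_unit : forall i, q i != 0.
Local Notation t := (Bq_t q).

Definition qV : {ffun vertex Q -> k} := [ffun i => (q i)^-1].

Lemma q_mulrV : q * qV = 1.
Proof. by apply/ffunP => i; rewrite !ffunE divff. Qed.

Lemma Bq_t_comm s : base s * t = t * base s.
Proof.
rewrite -[base s in LHS](algHom_base (adj_in (loc_rel (Bq_den q)))).
rewrite -[base s in RHS](algHom_base (adj_in (loc_rel (Bq_den q)))) /=.
by rewrite /Bq_t -!rmorphM kIvar_comm.
Qed.

Definition Bq_u : Bq q := adj_gen (loc_rel (Bq_den q)) tt.

Lemma Bq_denE : adj_cst (loc_rel (Bq_den q)) (Bq_den q tt) = base q + t.
Proof. exact: rmorphD. Qed.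

Lemma Bq_mulVr : Bq_u * (base q + t) = 1.
Proof.
by rewrite -Bq_denE /Bq_u /adj_gen /adj_cst -adj_piM; apply/adj_piE;
  apply: AdjRel; apply: LocL.
Qed.
Lemma Bq_mulrV : (base q + t) * Bq_u = 1.
Proof.
by rewrite -Bq_denE /Bq_u /adj_gen /adj_cst -adj_piM; apply/adj_piE;
  apply: AdjRel; apply: LocR.
Qed.

Lemma Bq_ind (P : Bq q -> Prop) :
  (forall s, P (base s)) -> P t -> P Bq_u ->
  (forall x y, P x -> P y -> P (x + y)) -> (forall x, P x -> P (- x)) ->
  (forall x y, P x -> P y -> P (x * y)) -> forall x, P x.
Proof.
move=> Ps Pt Pu PD PN PM; apply: adjoin_ind => [|[]||| ] //.
apply: adjoin_ind => [s|[]|x y|x|x y].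
- exact: Ps.
- exact: Pt.
- by rewrite rmorphD; apply: PD.
- by rewrite rmorphN; apply: PN.
- by rewrite rmorphM; apply: PM.
Qed.

(** This is B = kQ_0 + tB: the sum is closed under products because t commutes with kQ_0, and it
    contains the inverse of q + t because q is invertible. *)
Lemma Bq_split b : exists s b', b = base s + t * b'.
Proof.
elim/Bq_ind: b => [s||| b c [s [b' ->]] [s' [c' ->]]|b [s [b' ->]]
                  |b c [s [b' ->]] [s' [c' ->]]].
- by exists s, 0; rewrite mulr0 addr0.
- by exists 0, 1; rewrite rmorph0 mulr1 add0r.
(* From (q + t) u = 1 follows u = q^{-1} - t q^{-1} u. *)
- exists qV, (- (base qV * Bq_u)).
  have E : base q * Bq_u = 1 - t * Bq_u by rewrite -Bq_mulrV mulrDl addrK.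
  rewrite mulrN mulrA -Bq_t_comm -mulrA -{1}[base qV]mulr1 -mulrBr -E mulrA.
  by rewrite -rmorphM (kI_mulC (qV : kI _ _)) q_mulrV rmorph1 mul1r.
- by exists (s + s'), (b' + c'); rewrite rmorphD mulrDr addrACA.
- by exists (- s), (- b'); rewrite rmorphN mulrN opprD.
- exists (s * s'), (base s * c' + b' * (base s' + t * c')).
  rewrite rmorphM mulrDl mulrDr -addrA; congr (_ + _).
  by rewrite [RHS]mulrDr !mulrA Bq_t_comm.
Qed.

End LocalizedPolynomials.

(** * Reduced words in the free product of P and B *)

Section Words.
Variables (k : fieldType) (Q : quiver) (q : {ffun vertex Q -> k}).
Hypothesis q_unit : forall i, q i != 0.
Variable P : vAlgType k (vertex Q).
Local Notation F := (freeprod P (Bq q)).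
Local Notation fl := (fpl P (Bq q)).
Local Notation fr := (fpr P (Bq q)).

Definition word (a0 : P) (w : seq (Bq q * P)) : F :=
  fl a0 * \prod_(p <- w) (fr p.1 * fl p.2).

Definition reduced (w : seq (Bq q * P)) : Prop :=
  forall p, p \in w -> exists b, p.1 = Bq_t q * b.

(** The span of the reduced words contains 1 and is stable under left multiplication: an element of
    P is absorbed into a_0, and b = s + t b' splits into a part absorbed likewise and a new letter t
    b'. *)
Lemma word_span (x : F) : forall C : F -> Prop,
  (forall x y, C x -> C y -> C (x + y)) -> (forall x, C x -> C (- x)) ->
  (forall a w, reduced w -> C (word a w)) -> C x.
Proof.
(* With C arbitrary, the product case can use the hypothesis for x' on the predicate sending z to
   [C (x * z)]. *)
suff E (C : F -> Prop) :
    (forall x y, C x -> C y -> C (x + y)) -> (forall x, C x -> C (- x)) ->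
    (forall a w, reduced w -> C (word a w)) ->
    forall a w, reduced w -> C (x * word a w).
  move=> C CD CN Cw; have := E C CD CN Cw 1 [::].
  by rewrite /word big_nil rmorph1 !mulr1; apply.
elim/freeprod_ind: x C => [b|b|x x' IH IH'|x IH|x x' IH IH'] C CD CN Cw a w ww.
- by rewrite /word mulrA -rmorphM; apply: Cw.
- have [s [b' ->]] := Bq_split q_unit b; rewrite rmorphD mulrDl; apply: CD.
    by rewrite algHom_base -(algHom_base fl) /word mulrA -rmorphM; apply: Cw.
  rewrite (_ : _ * _ = word 1 ((Bq_t q * b', a) :: w)).
    by apply: Cw => p; rewrite inE => /orP[/eqP->|/ww //]; exists b'.
  by rewrite /word big_cons rmorph1 mul1r /= !mulrA.
- by rewrite mulrDl; apply: (CD); [apply: IH|apply: IH'].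
- by rewrite mulNr; apply: (CN); apply: IH.
- rewrite -mulrA; apply: (IH' (fun z => C (x * z))) => // [y z|y|a' w' ww'].
  + by rewrite mulrDr; apply: CD.
  + by rewrite mulrN; apply: CN.
  + exact: IH.
Qed.

End Words.

(** * Consequences of the strong free product property *)

Section StrongFreeProduct.
Variables (k : fieldType) (Q : quiver) (le : rel (arrow (doubleQ Q))).
Variables (q : {ffun vertex Q -> k}).
Hypothesis q_unit : forall i, q i != 0.
Variable sigma : preproj le q -> LQ k Q.
Hypothesis sigmaP : is_section sigma.
Local Notation L := (LQ k Q).
Local Notation r := (rel_elt le q).
Local Notation P := (preproj le q).
Local Notation F := (freeprod P (Bq q)).
Local Notation fl := (fpl P (Bq q)).
Local Notation fr := (fpr P (Bq q)).
Local Notation K := (koszul_alg L).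
Local Notation kin := (kin L).
Local Notation ks := (ks L).

Lemma section_zmod : zmod_morphism sigma.
Proof.
move=> x y; have [[D _] _ _] := sigmaP.
by apply: (addIr (sigma y)); rewrite -D !subrK.
Qed.
HB.instance Definition _ := GRing.isZmodMorphism.Build P L sigma section_zmod.

Lemma section_basel s x : sigma (base s * x) = base s * sigma x.
Proof.
have [[_ B] _ _] := sigmaP.
by have := B s 1 x; rewrite !rmorph1 !mulr1.
Qed.
Lemma section_baser x s : sigma (x * base s) = sigma x * base s.
Proof.
have [[_ B] _ _] := sigmaP.
by have := B 1 s x; rewrite !rmorph1 !mul1r.
Qed.

Variable sigma' : F -> L.
Hypothesis sigma'P : sigma_prime sigma sigma'.

Lemma sigma'_word a w : reduced w ->
  sigma' (word a w) = sigma a * \prod_(p <- w) (tau le q p.1 * sigma p.2).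
Proof. by case: sigma'P => _ H ww; apply: H. Qed.

Lemma sigma'_zmod : zmod_morphism sigma'.
Proof.
move=> x y; have [[D _] _] := sigma'P.
by apply: (addIr (sigma' y)); rewrite -D !subrK.
Qed.
HB.instance Definition _ := GRing.isZmodMorphism.Build F L sigma' sigma'_zmod.

Lemma sigma'_fl a : sigma' (fl a) = sigma a.
Proof.
by have := @sigma'_word a [::]; rewrite /word !big_nil !mulr1; apply.
Qed.

(** [sigma_prime] provides linearity over k only; on a reduced word, [base s] is absorbed into a_0,
    where [sigma] is kQ_0-linear. *)
Lemma sigma'_basel s x : sigma' (base s * x) = base s * sigma' x.
Proof.
elim/(word_span q_unit): x => [x y Hx Hy|x Hx|a w ww].
- by rewrite mulrDr !raddfD /= Hx Hy mulrDr.
- by rewrite mulrN !raddfN /= Hx mulrN.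
- rewrite /word mulrA -(algHom_base fl) -rmorphM -!/(word _ _).
  by rewrite !sigma'_word // section_basel mulrA.
Qed.

(** Prefixing the letter t to a reduced word leaves it reduced, and [tau] sends t to r. *)
Lemma sigma'_insert a x :
  sigma' (fl a * fr (Bq_t q) * x) = sigma a * r * sigma' x.
Proof.
elim/(word_span q_unit): x => [x y Hx Hy|x Hx|a' w ww].
- by rewrite mulrDr !raddfD /= Hx Hy [RHS]mulrDr.
- by rewrite mulrN !raddfN /= Hx mulrN.
- rewrite (_ : _ * _ = word a ((Bq_t q, a') :: w)); last first.
    by rewrite /word big_cons !mulrA.
  rewrite !sigma'_word //; last first.
    move=> p; rewrite inE => /orP[/eqP->|/ww //]; by exists 1; rewrite mulr1.
  by rewrite big_cons /= tau_t !mulrA.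
Qed.

(** By surjectivity of [sigma'], words span L: the word without letters gives [sigma a], and
    otherwise the first letter t b makes the product start with [sigma a * r]. Later identities for
    [h] are checked on these two kinds of elements. *)
Lemma section_span g : cancel g sigma' -> forall C : L -> Prop,
  (forall x y, C x -> C y -> C (x + y)) -> (forall x, C x -> C (- x)) ->
  (forall a, C (sigma a)) -> (forall a l, C (sigma a * r * l)) ->
  forall l, C l.
Proof.
move=> gK C CD CN Cs Cr l; rewrite -(gK l).
elim/(word_span q_unit): (g l) => [x y Hx Hy|x Hx|a [|p w] ww].
- by rewrite raddfD; apply: CD.
- by rewrite raddfN; apply: CN.
- by rewrite sigma'_word // big_nil mulr1.
- rewrite sigma'_word // big_cons; have [b ->] := ww p (mem_head _ _).
  by rewrite rmorphM tau_t !mulrA -!(mulrA (sigma a * r)).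
Qed.

(* Additive maps F -> K stand in for the tensor product of P and F over kQ_0, whose
   elements a (x) y would map to kin (sigma a) * ks * kin (sigma' y). *)
Let delta_fun (a : P) (x : F) : K := kin (sigma a) * ks * kin (sigma' x).
Let delta_zmod a : zmod_morphism (delta_fun a).
Proof. by move=> x y; rewrite /delta_fun raddfB rmorphB mulrBr. Qed.
Let delta (a : P) : addmap F K := mk_addmap (delta_zmod a).

Let deltaE a x : delta a x = kin (sigma a) * ks * kin (sigma' x).
Proof. by []. Qed.

Let deltaB : {morph delta : x y / x - y}.
Proof.
move=> x y; apply: addmap_ext => z; rewrite addmapBE !deltaE.
by rewrite raddfB rmorphB !mulrBl.
Qed.

Let M := coind_rmod F K.

(** Balancedness over kQ_0: [base s] moves past [ks], from the right of [sigma a] to the left of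
    [sigma' x]. *)
Let delta_base a s : delta (a * base s) = ract M (base s) (delta a).
Proof.
apply: addmap_ext => x; rewrite [RHS]coind_actE !deltaE section_baser.
rewrite sigma'_basel !rmorphM !algHom_base -!mulrA (mulrA (base s)) ks_comm.
by rewrite -mulrA.
Qed.

Let t := fr (Bq_t q).
Let u := fr (Bq_u q).

Let t_comm s : base s * t = t * base s.
Proof. by have := congr1 fr (Bq_t_comm q s); rewrite !rmorphM algHom_base. Qed.

Let tuV : (base q + t) * u = 1.
Proof.
by rewrite /u /t -(algHom_base fr) -rmorphD -rmorphM Bq_mulrV rmorph1.
Qed.
Let utV : u * (base q + t) = 1.
Proof.
by rewrite /u /t -(algHom_base fr) -rmorphD -rmorphM Bq_mulVr rmorph1.
Qed.

Let T := fo_t t_comm deltaB delta_base.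
Let U := fo_inv deltaB delta_base (qV q) u.

(** [U] is a two-sided inverse of q + [T], so the action of t extends to the localization B. *)
Let phiB_rel (x y : term (kIpoly k (vertex Q)) unit) : loc_rel (Bq_den q) x y ->
  eval (poly_lift (fo_t_comm t_comm deltaB delta_base)) (fun=> U) x
  = eval (poly_lift (fo_t_comm t_comm deltaB delta_base)) (fun=> U) y.
Proof.
set p := poly_lift _.
have E : p (Bq_den q tt) = base q + T.
  by rewrite rmorphD poly_lift_var (algHom_base p).
case=> -[] /=; rewrite rmorph1 E.
  exact: fo_mulVr (q_mulrV q_unit) utV.
exact: fo_mulrV (q_mulrV q_unit) tuV.
Qed.

Let phi := fp_lift (fo_alg fl M) (adj_lift phiB_rel).

Let phi_t : phi t = T.
Proof. by rewrite /phi /t fp_lift_r /Bq_t adj_lift_cst poly_lift_var. Qed.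
Let phi_u : phi u = U.
Proof. by rewrite /phi /u fp_lift_r /Bq_u adj_lift_gen. Qed.

Let delta0 : delta 0 = 0.
Proof. by rewrite -(subrr 0) deltaB subrr. Qed.

Let phi_right x g : phi x (0, g) = (0, ract M x g).
Proof.
elim/freeprod_ind: x g => [a|b|x x' IH IH'|x IH|x x' IH IH'] g.
- by rewrite /phi fp_lift_l fo_algE /= mul0r.
- elim/Bq_ind: b g => [s|||x x' IH IH'|x IH|x x' IH IH'] g.
  + by rewrite !algHom_base endo_baseE fo_ractE /= mul0r.
  + by rewrite phi_t fo_tE /= delta0 add0r.
  + by rewrite phi_u fo_invE /= mul0r delta0 subr0.
  + by rewrite !rmorphD endoDE IH IH' ractDr; congr (_, _); rewrite /= addr0.
  + by rewrite !rmorphN endoNE IH ractNr; congr (_, _); apply: oppr0.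
  + by rewrite !rmorphM endoME IH IH' ractM.
- by rewrite !rmorphD endoDE IH IH' ractDr; congr (_, _); rewrite /= addr0.
- by rewrite !rmorphN endoNE IH ractNr; congr (_, _); apply: oppr0.
- by rewrite !rmorphM endoME IH IH' ractM.
Qed.

Let phi_fl a : phi (fl a) (1, 0) = (a, 0).
Proof.
rewrite /phi fp_lift_l fo_algE; congr (_, _); first exact: mul1r.
exact: (ract0l M).
Qed.

(** An action of the free product respects its relations, so replacing the first t by s is well
    defined without appeal to uniqueness of reduced words. *)
Lemma sigma'_first_occurrence : exists h : F -> K, [/\ zmod_morphism h,
  forall a, h (fl a) = 0 &
  forall a x, h (fl a * fr (Bq_t q) * x) = kin (sigma a) * ks * kin (sigma' x)].
Proof.
(* The word a t x leads from (1, 0) through (a, 0) and (0, delta a) to the map [delta a] acted on by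
   x, whose value at 1 is [delta a x]. *)
exists (fun x => (phi x (1, 0)).2 1); split.
- by move=> x y /=; rewrite rmorphB -addmapBE.
- by move=> a; rewrite phi_fl.
- move=> a x; rewrite !rmorphM !endoME phi_t phi_fl fo_tE.
  by rewrite (ract0l M) addr0 phi_right /= mulr1.

Qed.

End StrongFreeProduct.

(** * The homotopy on K, its homology and formality *)

Section KoszulHomotopy.
Variables (k : fieldType) (I : finType) (L : vAlgType k I) (r : L).
Hypothesis Hr : forall s, base s * r = r * base s.
Variables (P : vAlgType k I) (pi : algHom L P) (sigma : P -> L).
Local Notation K := (koszul_alg L).
Local Notation kin := (kin L).
Local Notation ks := (ks L).
Local Notation d := (koszul_d Hr).
Local Notation sg := (koszul_sg Hr).

Hypothesis sigmaB : zmod_morphism sigma.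
Hypothesis sigma_base : forall a s, sigma (a * base s) = sigma a * base s.
Hypothesis sigmaK : forall a, pi (sigma a) = a.
Hypothesis pi_r : pi r = 0.
Hypothesis span : forall C : L -> Prop,
  (forall x y, C x -> C y -> C (x + y)) -> (forall x, C x -> C (- x)) ->
  (forall a, C (sigma a)) -> (forall a l, C (sigma a * r * l)) ->
  forall l, C l.
Variable h : L -> K.
Hypothesis hB : zmod_morphism h.
Hypothesis h_sigma : forall a, h (sigma a) = 0.
Hypothesis h_sigma_r :
  forall a l, h (sigma a * r * l) = kin (sigma a) * ks * kin l.

HB.instance Definition _ := GRing.isZmodMorphism.Build P L sigma sigmaB.
HB.instance Definition _ := GRing.isZmodMorphism.Build L K h hB.

Lemma h_base a s : h (a * base s) = h a * base s.
Proof.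
elim/span: a => [x y Hx Hy|x Hx|a|a l].
- by rewrite mulrDl !raddfD /= Hx Hy mulrDl.
- by rewrite mulNr !raddfN /= Hx mulNr.
- by rewrite -sigma_base !h_sigma mul0r.
- by rewrite -mulrA !h_sigma_r rmorphM algHom_base !mulrA.
Qed.

Lemma pi_r_ideal l l' : pi (l * r * l') = 0.
Proof. by rewrite !rmorphM pi_r mulr0 mul0r. Qed.

(** For l = [sigma a] the first summand vanishes. For l = [sigma a * r * m] the second does, as [pi]
    kills r, and on both sides [h] replaces the r following [sigma a]. *)
Lemma h_insert l l' :
  h (l * r * l') = h l * kin (r * l') + kin (sigma (pi l)) * ks * kin l'.
Proof.
elim/span: l => [x y Hx Hy|x Hx|a|a l].
- by rewrite !mulrDl !raddfD /= Hx Hy !mulrDl addrACA.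
- by rewrite !mulNr !raddfN /= Hx !mulNr opprD.
- by rewrite h_sigma mul0r add0r sigmaK h_sigma_r.
- rewrite pi_r_ideal raddf0 rmorph0 !mul0r addr0.
  by rewrite -!(mulrA (sigma a * r)) !h_sigma_r -!mulrA -!rmorphM !mulrA.
Qed.

Lemma sigma_piD x y : sigma (pi (x + y)) = sigma (pi x) + sigma (pi y).
Proof. by rewrite rmorphD raddfD. Qed.
Lemma sigma_piN x : sigma (pi (- x)) = - sigma (pi x).
Proof. by rewrite rmorphN raddfN. Qed.

(** Both sides vanish on [sigma a]; on [sigma a * r * l] the projection term vanishes and d turns
    the s made by [h] back into r. *)
Lemma d_h l : d (h l) = kin (l - sigma (pi l)).
Proof.
elim/span: l => [x y Hx Hy|x Hx|a|a l].
- by rewrite raddfD koszul_dD /= Hx Hy -rmorphD sigma_piD opprD addrACA.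
- by rewrite raddfN koszul_dN /= Hx -rmorphN sigma_piN opprD.
- by rewrite h_sigma koszul_d0 sigmaK subrr rmorph0.
- rewrite h_sigma_r pi_r_ideal raddf0 subr0 !koszul_dM !koszul_d_in koszul_d_s.
  by rewrite mulr0 addr0 mul0r add0r koszul_sg_in -!rmorphM.
Qed.

Lemma sg_h l : sg (h l) = - h l.
Proof.
elim/span: l => [x y Hx Hy|x Hx|a|a l].
- by rewrite raddfD koszul_sgD /= Hx Hy opprD.
- by rewrite raddfN koszul_sgN /= Hx.
- by rewrite h_sigma koszul_sg0 oppr0.
- by rewrite h_sigma_r !koszul_sgM !koszul_sg_in koszul_sg_s mulrN mulNr.
Qed.

Lemma koszul_span (x : K) : forall C : K -> Prop,
  (forall x y, C x -> C y -> C (x + y)) -> (forall x, C x -> C (- x)) ->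
  (forall a, C (kin a)) -> (forall a x, C (kin a * ks * x)) -> C x.
Proof.
(* The prefix 1 is generalized to any l in L, so that a product can be read from left to right. *)
move=> C CD CN Cin Cs; rewrite -[x]mul1r -(rmorph1 kin).
elim/koszul_ind: x 1 C CD CN Cin Cs
  => [a||x y Hx Hy|x Hx|x y Hx Hy] l C CD CN Cin Cs.
- by rewrite -rmorphM.
- by rewrite -[_ * ks]mulr1.
- by rewrite mulrDr; apply: (CD); [apply: Hx|apply: Hy].
- by rewrite mulrN; apply: (CN); apply: Hx.
- rewrite mulrA; apply: (Hx _ (fun z => C (z * y))) => [z w|z|a|a z].
  + by rewrite mulrDl; apply: CD.
  + by rewrite mulNr; apply: CN.
  + exact: Hy.
  + by rewrite -mulrA.
Qed.

Definition koszul_proj : algHom K P :=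
  koszul_lift pi (c := 0) (fun s => etrans (mulr0 (base s)) (esym (mul0r (base s)))).

Lemma koszul_proj_in a : koszul_proj (kin a) = pi a.
Proof. exact: koszul_lift_in. Qed.
Lemma koszul_proj_s : koszul_proj ks = 0. Proof. exact: koszul_lift_s. Qed.

Variable H : K -> K.
Hypothesis H_zmod : zmod_morphism H.
Hypothesis H_in : forall a, H (kin a) = h a.
Hypothesis H_s : forall a x, H (kin a * ks * x) = h a * ks * x.
HB.instance Definition _ := GRing.isZmodMorphism.Build K K H H_zmod.

(** [H] acts only before the first s, so [h_insert] applies, either to x in L or to the part of x
    before its first s. *)
Lemma H_insert l x :
  H (kin l * kin r * x) = h l * kin r * x + kin (sigma (pi l)) * ks * x.
Proof.
elim/koszul_span: x => [x y Hx Hy|x Hx|a|a x].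
- by rewrite !mulrDr raddfD /= Hx Hy addrACA.
- by rewrite !mulrN raddfN /= Hx opprD.
- by rewrite -!rmorphM H_in h_insert rmorphM mulrA.
- rewrite !mulrA -!rmorphM H_s h_insert rmorphM !mulrDl !mulrA.
  by rewrite -!mulrA.
Qed.

(** On a word l s x, the terms h(l) r x and h(l) s d(x) cancel between d H and H d, and the term
    sigma(pi(l)) s x missing from d(h(l)) s x is supplied by [H_insert]. *)
Lemma koszul_homotopy x : d (H x) + H (d x) = x - kin (sigma (koszul_proj x)).
Proof.
elim/koszul_span: x => [x y Hx Hy|x Hx|a|l x].
- by rewrite koszul_dD !raddfD koszul_dD addrACA Hx Hy /= addrACA -opprD.
- by rewrite koszul_dN !raddfN koszul_dN -opprD Hx /= opprB opprK addrC.
- by rewrite koszul_d_in raddf0 addr0 H_in d_h rmorphB koszul_proj_in.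
- rewrite H_s !rmorphM koszul_proj_s mulr0 mul0r raddf0 rmorph0 subr0.
  rewrite !koszul_dM !koszul_sgM d_h sg_h koszul_d_in koszul_d_s koszul_sg_in.
  rewrite koszul_sg_s mul0r add0r mulrN !mulNr mulrN mulNr opprK rmorphB raddfB /=.
  rewrite H_insert H_s !mulrBl addrACA subrr addr0.
  by rewrite addrA !subrK.
Qed.

Lemma koszul_proj_d x : koszul_proj (d x) = 0.
Proof.
elim/koszul_ind: x => [a||x y Hx Hy|x Hx|x y Hx Hy].
- by rewrite koszul_d_in rmorph0.
- by rewrite koszul_d_s koszul_proj_in.
- by rewrite koszul_dD rmorphD Hx Hy addr0.
- by rewrite koszul_dN rmorphN Hx oppr0.
- by rewrite koszul_dM rmorphD !rmorphM Hx Hy mul0r mulr0 addr0.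
Qed.

Lemma koszul_proj_deg n x : koszul_deg n x -> n != 0 -> koszul_proj x = 0.
Proof.
elim=> {n x} [//||n|n x y _ IHx _ IHy|m n x y _ IHx _ IHy] n0.
- exact: koszul_proj_s.
- exact: rmorph0.
- by rewrite rmorphB IHx ?IHy ?subr0.
- rewrite rmorphM; have [m0|m0] := eqVneq m 0; last by rewrite IHx ?mul0r.
  by rewrite IHy ?mulr0 //; move: n0; rewrite m0 add0r.
Qed.

Local Notation D := (koszul_dg Hr).

Lemma cycle_boundary z : d z = 0 -> koszul_proj z = 0 -> z = d (H z).
Proof.
move=> dz pz; have := koszul_homotopy z.
by rewrite dz raddf0 addr0 pz raddf0 rmorph0 subr0.
Qed.

Lemma kin_cycle a : @Defs.cycle k I D (kin a).
Proof. exact: koszul_d_in. Qed.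

Definition homology_class (a : L) : homology D :=
  hom_class (subalg_in (cycle_subalg D) (kin_cycle a)).

Fact homology_class_zmod : zmod_morphism homology_class.
Proof.
move=> a b; rewrite /homology_class /hom_class -rmorphB; congr (quot_pi _ _).
by apply: val_inj; rewrite /= !rmorphB.
Qed.
Fact homology_class_monoid : monoid_morphism homology_class.
Proof.
split=> [|a b]; rewrite /homology_class /hom_class -?rmorphM
  -?(rmorph1 (quot_pi _)); congr (quot_pi _ _); apply: val_inj; rewrite /= ?rmorph1 ?rmorphM //.
Qed.
HB.instance Definition _ := GRing.isZmodMorphism.Build L (homology D)
  homology_class homology_class_zmod.
HB.instance Definition _ := GRing.isMonoidMorphism.Build L (homology D)
  homology_class homology_class_monoid.
Fact homology_class_base s : homology_class (base s) = base s.
Proof. by congr (quot_pi _ _); apply: val_inj; apply: (algHom_base kin). Qed.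

Definition homology_class_hom : algHom L (homology D) :=
  @AlgHom _ _ L (homology D) homology_class homology_class_base.

(** The difference z - w is a cycle killed by the projection, hence the boundary of its image under
    [H]. So the projection is injective on homology. *)
Lemma hom_class_eq (z w : cycles D) :
  koszul_proj (val z) = koszul_proj (val w) -> hom_class z = hom_class w.
Proof.
move=> E; apply/quot_piE; exists (H (val (z - w))).
apply: cycle_boundary; first exact: (subalg_inP (z - w)).
by rewrite !rmorphB E subrr.
Qed.

Lemma hom_class_proj (z w : cycles D) :
  hom_class z = hom_class w -> koszul_proj (val z) = koszul_proj (val w).
Proof.
move=> /quot_piE[y Ey]; apply/eqP; rewrite -subr_eq0 -rmorphB.
have -> : val z - val w = d y by rewrite -[RHS]Ey [RHS]rmorphB.
by rewrite koszul_proj_d.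
Qed.

Lemma homology_vanish n x : n != 0 -> dg_deg (homology D) n x -> x = 0.
Proof.
move=> n0 [z [Hz ->]]; rewrite -(rmorph0 (quot_pi _)); apply: hom_class_eq.
by rewrite (koszul_proj_deg Hz n0) !rmorph0.
Qed.

Definition hproj_fun (x : homology D) : P :=
  koszul_proj (val (repr (x : quot (boundary_ideal D)))).

Lemma hproj_class z : hproj_fun (hom_class z) = koszul_proj (val z).
Proof. by apply: hom_class_proj; apply: quot_reprK. Qed.

Fact hproj_zmod : zmod_morphism hproj_fun.
Proof.
elim/quot_ind=> z; elim/quot_ind=> w.
rewrite -(rmorphB (quot_pi _)) !hproj_class.
by rewrite !rmorphB.
Qed.
Fact hproj_monoid : monoid_morphism hproj_fun.
Proof.
split=> [|].
  by rewrite -(rmorph1 (quot_pi _)) hproj_class rmorph1.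
elim/quot_ind=> z; elim/quot_ind=> w.
by rewrite -(rmorphM (quot_pi _)) !hproj_class -[RHS]rmorphM.
Qed.

Lemma homology_class_sigma_proj (z : cycles D) :
  hom_class z = homology_class (sigma (koszul_proj (val z))).
Proof. by apply: hom_class_eq; rewrite /= koszul_proj_in sigmaK. Qed.

Lemma homology_class_pi a b : pi a = pi b -> homology_class a = homology_class b.
Proof. by move=> E; apply: hom_class_eq; rewrite /= !koszul_proj_in. Qed.

Lemma hproj_class_in a : hproj_fun (homology_class a) = pi a.
Proof. by rewrite hproj_class /= koszul_proj_in. Qed.

Lemma homology_class_deg a : dg_deg (homology D) 0 (homology_class a).
Proof.
exists (subalg_in (cycle_subalg D) (kin_cycle a)); split=> //.
exact: KDeg_in.
Qed.

HB.instance Definition _ := GRing.isZmodMorphism.Build (homology D) P hproj_fun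
  hproj_zmod.
HB.instance Definition _ := GRing.isMonoidMorphism.Build (homology D) P hproj_fun
  hproj_monoid.

Lemma homology_class_sigma_hproj x : homology_class (sigma (hproj_fun x)) = x.
Proof.
by elim/quot_ind: x => z; rewrite [RHS]homology_class_sigma_proj hproj_class.
Qed.

Local Notation H0 := (degree0 (homology D)).
Definition hproj0_fun (x : H0) : P := hproj_fun (val x).
Fact hproj0_zmod : zmod_morphism hproj0_fun.
Proof. by move=> x y; rewrite /hproj0_fun !rmorphB. Qed.
Fact hproj0_monoid : monoid_morphism hproj0_fun.
Proof. by split=> [|x y]; rewrite /hproj0_fun ?rmorph1 ?rmorphM. Qed.
HB.instance Definition _ := GRing.isZmodMorphism.Build H0 P hproj0_fun
  hproj0_zmod.
HB.instance Definition _ := GRing.isMonoidMorphism.Build H0 P hproj0_fun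
  hproj0_monoid.
Fact hproj0_base s : hproj0_fun (base s) = base s.
Proof.
by rewrite /hproj0_fun -[val _]homology_class_base hproj_class_in algHom_base.
Qed.
Definition hproj0 : algHom H0 P := @AlgHom _ _ H0 P hproj0_fun hproj0_base.

Lemma homology0_iso : alg_isomorphic H0 P.
Proof.
exists hproj0.
exists (fun a => subalg_in (degree0_subalg (homology D))
                   (homology_class_deg (sigma a))).
  by move=> x; apply: val_inj; apply: homology_class_sigma_hproj.
by move=> a; rewrite /= /hproj0_fun /= hproj_class_in sigmaK.
Qed.

Definition formality_alg : algHom D (homology D) :=
  koszul_lift homology_class_hom (c := 0)
    (fun s => etrans (mulr0 (base s)) (esym (mul0r (base s)))).

Lemma formality_alg_in a : formality_alg (kin a) = homology_class a.
Proof. exact: koszul_lift_in. Qed.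

(** [sigma] need not be multiplicative, but by [homology_class_pi] the class of l depends only on
    [pi l], so the right-hand side respects sums and products and generators suffice. *)
Lemma formality_algE x : formality_alg x = homology_class (sigma (koszul_proj x)).
Proof.
elim/koszul_ind: x => [a||x y Hx Hy|x Hx|x y Hx Hy].
- rewrite formality_alg_in; apply: homology_class_pi.
  by rewrite koszul_proj_in sigmaK.
- by rewrite koszul_proj_s raddf0 rmorph0; apply: koszul_lift_s.
- rewrite [LHS]rmorphD Hx Hy -rmorphD; apply: homology_class_pi.
  by rewrite rmorphD !sigmaK [koszul_proj (_ + _)]rmorphD.
- rewrite [LHS]rmorphN Hx -rmorphN; apply: homology_class_pi.
  by rewrite rmorphN !sigmaK [koszul_proj (- _)]rmorphN.
- rewrite [LHS]rmorphM Hx Hy -rmorphM; apply: homology_class_pi.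
  by rewrite rmorphM !sigmaK [koszul_proj (_ * _)]rmorphM.
Qed.

Fact formality_deg n x : dg_deg D n x -> dg_deg (homology D) n (formality_alg x).
Proof.
rewrite formality_algE => Hx.
have [->|n0] := eqVneq n 0; first exact: homology_class_deg.
by rewrite (koszul_proj_deg Hx n0) raddf0 rmorph0; apply: dg_deg0.
Qed.

Fact formality_d x : formality_alg (dg_d D x) = dg_d (homology D) (formality_alg x).
Proof. by rewrite formality_algE koszul_proj_d raddf0 rmorph0. Qed.

Definition formality_map : dgHom D (homology D) := DgHom formality_deg formality_d.

Lemma formality_quasi_iso : quasi_iso formality_map.
Proof.
(* The differential of the homology is 0, so a class in its homology has a single representative. *)
pose inv (y : homology (homology D)) : homology D :=
  val (repr (y : quot (boundary_ideal (homology D)))).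
have invE (z : cycles (homology D)) : inv (hom_class z) = val z.
  have [y Ey] := quot_repr_pi (boundary_ideal (homology D)) z.
  by apply/eqP; rewrite -subr_eq0; move: Ey; rewrite [LHS]rmorphB => ->.
exists inv.
  elim/quot_ind=> z; rewrite homology_mapE invE /=.
  by rewrite formality_algE [RHS]homology_class_sigma_proj.
elim/quot_ind=> z; rewrite [inv _]invE.
(* A preimage is the class of a cycle w of K, since the formality map sends w to its own class. *)
have [w Ew] : exists w, val z = hom_class w.
  by elim/quot_ind: (val z) => w; exists w.
rewrite Ew homology_mapE; congr (quot_pi _ _); apply: val_inj.
rewrite [RHS]Ew homology_class_sigma_proj; exact: formality_algE.
Qed.

Lemma koszul_formal :
  [/\ forall (n : int) (x : homology D),
        n != 0 -> dg_deg (homology D) n x -> x = 0,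
      alg_isomorphic (degree0 (homology D)) P
    & formal D].
Proof.
split; [exact: homology_vanish|exact: homology0_iso|].
by apply: rst_step; exists formality_map; apply: formality_quasi_iso.
Qed.

End KoszulHomotopy.

Theorem proposition4p4 (k : fieldType) (Q : quiver)
    (le : rel (arrow (doubleQ Q))) (le_total : is_total_order le)
    (q : {ffun vertex Q -> k}) (q_unit : forall i, q i != 0)
    (sfp : exists sigma : preproj le q -> LQ k Q, strong_free_product sigma) :
  [/\ forall (n : int) (x : homology (dg_preproj le q)),
        n != 0 -> dg_deg (homology (dg_preproj le q)) n x -> x = 0,
      alg_isomorphic (degree0 (homology (dg_preproj le q))) (preproj le q)
    & formal (dg_preproj le q)].
Proof.
have [sigma [sigmaP [sigma' [sigma'P [g gK Kg]]]]] := sfp.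
have [h0 [h0B h0_fl h0_t]] := sigma'_first_occurrence q_unit sigmaP sigma'P.
have gB : zmod_morphism g.
  by move=> x y; rewrite -[RHS]gK (sigma'_zmod sigma'P) !Kg.
(* [g] writes l as a combination of words, in which [h0] replaces the first t by s. *)
pose h l := h0 (g l).
have hB : zmod_morphism h by move=> x y; rewrite /h gB h0B.
have h_sigma a : h (sigma a) = 0.
  by rewrite /h -(sigma'_fl sigma'P) gK h0_fl.
have h_sigma_r a l : h (sigma a * rel_elt le q * l)
    = kin _ (sigma a) * ks _ * kin _ l.
  by rewrite /h -{1}(Kg l) -(sigma'_insert q_unit sigma'P) gK h0_t Kg.
have span := section_span q_unit sigma'P Kg.
have sigmaK : forall a, preproj_pi le q (sigma a) = a by case: sigmaP.
have pi_r : preproj_pi le q (rel_elt le q) = 0.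
  by rewrite -(rmorph0 (preproj_pi le q)); apply/quot_piE; rewrite subr0;
    apply: principal_gen.
have sB := section_zmod sigmaP; have sb := section_baser sigmaP.
have hb := h_base sb span hB h_sigma h_sigma_r.
have [H [H_zmod H_in H_s]] := koszul_extend hB hb.
exact: (koszul_formal (base_rel_elt le q) sB sigmaK pi_r span hB h_sigma
  h_sigma_r H_zmod H_in H_s).
Qed.
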